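(* Let $G$ be a compact topological group, let $X$ be a $G$-valued random variable with the normalized Haar measure on $G$, and let $Y$ be a $G$-valued random variable independent of $X$ such that (i) $Y^{-1}$ has the same distribution as $Y$, and (ii) for every $x\in G$, $xYx^{-1}$ has the same distribution as $Y$. Let $f:G\to\mathbb{R}$ be a bounded measurable function with $\mathbb{E}f(X)=0$. Let $Y_1,Y_2,\ldots$ be i.i.d. copies of $Y$, and suppose $a,b>0$ are constants such that $d_{TV}(Y_1Y_2\cdots Y_k,X)\le a e^{-bk}$ for every $k\ge 1$. Let $A,B>0$ satisfy $\|f\|_\infty\le A$ and $\|f\|_Y\le B$, and set \[ C=\frac{B^2}{b}\Bigl[\Bigl(\log\frac{4aA}{B}\Bigr)^+ +\frac{b}{1-e^{-b}}\Bigr]. \] Then $\operatorname{Var}(f(X))\le C/2$, and for every $t\ge 0$, $\mathbb{P}\{|f(X)|\ge t\}\le 2e^{-t^2/C}$.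
   Context: The normalized Haar measure on a compact group $G$ is the unique probability measure such that if $X$ has this law then $xX$, $Xx$ and $X^{-1}$ have the same law as $X$ for every $x\in G$. $\|f\|_\infty=\sup_{x\in G}|f(x)|$ and $\|f\|_Y=\sup_{x\in G}\bigl[\mathbb{E}(f(x)-f(Yx))^2\bigr]^{1/2}$. $d_{TV}(U,V)=\sup_{E}|\mathbb{P}(U\in E)-\mathbb{P}(V\in E)|$ over Borel sets $E$ is the total variation distance between the laws of $U$ and $V$. $(u)^+=\max(u,0)$. *)

(* Defs.v *)
From HB Require Import structures.
From mathcomp Require Import all_boot all_order all_algebra.
From mathcomp Require Import monoid.
From mathcomp Require Import all_classical all_reals all_analysis.

Set Implicit Arguments.
Unset Strict Implicit.
Unset Printing Implicit Defensive.

Import Order.TTheory GRing.Theory Num.Theory.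
Import numFieldNormedType.Exports.

Local Open Scope classical_set_scope.
Local Open Scope ring_scope.

(* A (not necessarily commutative) group carrying a topology. Continuity of
   the group operations and compactness are stated as hypotheses. *)
HB.structure Definition TopGroup := {G of Group G & PointedTopological G}.

Definition borel_sets (G : ptopologicalType) : set (set G) := <<s @open G >>.

Section Defs.
Context {R : realType}.

Definition is_grv {d} {Omega : measurableType d} {G : ptopologicalType}
  (X : Omega -> G) : Prop :=
  @measurable_fun _ _ Omega (g_sigma_algebraType (@open G)) [set: Omega] X.

Definition borel_measurable_fun {G : ptopologicalType} (f : G -> R) : Prop :=
  @measurable_fun _ _ (g_sigma_algebraType (@open G)) R
    [set: g_sigma_algebraType (@open G)] f.

Definition same_law {d d'} {Omega : measurableType d} {Omega' : measurableType d'}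
  (P : probability Omega R) (P' : probability Omega' R) {G : ptopologicalType}
  (X : Omega -> G) (X' : Omega' -> G) : Prop :=
  forall E : set G, borel_sets E -> P (X @^-1` E) = P' (X' @^-1` E).

Definition haar_distributed {d} {Omega : measurableType d}
  (P : probability Omega R) {G : TopGroup.type} (X : Omega -> G) : Prop :=
  forall x : G,
    [/\ same_law P P X (fun w => (x * X w)%g),
        same_law P P X (fun w => (X w * x)%g)
      & same_law P P X (fun w => (X w)^-1%g)].

Definition indep2 {d} {Omega : measurableType d} (P : probability Omega R)
  {G : ptopologicalType} (X Y : Omega -> G) : Prop :=
  forall E F : set G, borel_sets E -> borel_sets F ->
    P (X @^-1` E `&` Y @^-1` F) = (P (X @^-1` E) * P (Y @^-1` F))%E.

Definition mutually_indep {d} {Omega : measurableType d}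
  (P : probability Omega R) {G : ptopologicalType} (Ys : nat -> Omega -> G) : Prop :=
  forall (n : nat) (E : nat -> set G), (forall i, borel_sets (E i)) ->
    fine (P (\bigcap_(i in `I_n) (Ys i @^-1` E i))) =
    \prod_(i < n) fine (P (Ys i @^-1` E i)).

Definition dTV {d d'} {Omega : measurableType d} {Omega' : measurableType d'}
  (P : probability Omega R) (P' : probability Omega' R) {G : ptopologicalType}
  (U : Omega -> G) (V : Omega' -> G) : \bar R :=
  ereal_sup [set (`| fine (P (U @^-1` E)) - fine (P' (V @^-1` E)) |)%:E
            | E in borel_sets (G := G)].

Definition sup_norm {G : Type} (f : G -> R) : \bar R :=
  ereal_sup [set (`| f x |)%:E | x in [set: G]].

Definition Y_norm {d} {Omega : measurableType d} (P : probability Omega R)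
  {G : TopGroup.type} (Y : Omega -> G) (f : G -> R) : \bar R :=
  ereal_sup [set (Num.sqrt (fine ('E_P[fun w => (f x - f (Y w * x)%g) ^+ 2])))%:E
            | x in [set: G]].

End Defs.

(* Main.v *)
(** Write [P h x = E h(Y x)] and [h_k = P^k f]; mixing gives [|h_k| <= 2 a A exp(-bk)],
    and conjugation invariance of [Y] gives [||h_k||_Y <= ||f||_Y].  As [(X, YX)] is
    exchangeable, [E u(X) (h_k - P h_k)(X)] is half of
    [E (u(X) - u(YX)) (h_k(X) - h_k(YX))], and telescoping over [k] bounds
    [E u(X) f(X)] in terms of [sum_k min(B, 4 a A exp(-bk)) <= C / B].  The choice
    [u = f] bounds the variance, and [u = exp(t f)] bounds the logarithmic derivative
    of the Laplace transform of [f(X)].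

    The group is not assumed second countable, so that multiplication need not be
    jointly Borel measurable and Fubini's theorem does not apply to [f(YX)].  However,
    modulo Haar-null sets, every Borel set comes from a second countable quotient of
    [G]: [f] is replaced by a function that differs from it on a null set and is
    measurable for the Borel sets of such a quotient. *)
Require Import Defs.
From HB Require Import structures.
From mathcomp Require Import all_boot all_order all_algebra.
From mathcomp Require Import monoid.
From mathcomp Require Import all_classical all_reals all_analysis.
From mathcomp Require Import measurable_realfun ring lra.

Set Implicit Arguments.
Unset Strict Implicit.
Unset Printing Implicit Defensive.

Import Order.TTheory GRing.Theory Num.Theory.
Import numFieldNormedType.Exports.

Local Open Scope classical_set_scope.
Local Open Scope ring_scope.

(** * Integration of bounded measurable functions against probability measures *)

Section bounded_measurable.
Context {R : realType}.

(** The walk is studied on an abstract set [T] with jointly measurable multiplication, so that the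
    estimates apply to [G] with the coarser sigma-algebra of one quotient. Replacing [f] by [g]
    there has a price: [|g| <= A] holds everywhere, which makes mixing uniform in the starting
    point, but [||g||_Y <= B], a supremum over all points, survives only almost everywhere. Hence
    the essential bound [ess_le], which has to be passed on from each iterate to the next.

    With [L = max(log(4 a A / B), 0)], the bound for [h_k] is [B min(1, exp(L - b k))]. The terms
    before decay sets in contribute [L / b], the geometric tail [1 / (1 - exp(-b))]; the second
    factor [B] in [C] is the bound for the differences of [f] itself. *)

Definition bmf {d} {T : measurableType d} (h : T -> R) : Prop :=
  measurable_fun [set: T] h /\ exists M : R, forall x, `|h x| <= M.

Section closure.
Context {d} {T : measurableType d}.
Implicit Types g h : T -> R.

Lemma bmf_cst (c : R) : bmf (fun _ : T => c).
Proof. by split; [exact: measurable_cst|exists `|c|]. Qed.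

Lemma bmfD g h : bmf g -> bmf h -> bmf (fun x => g x + h x).
Proof.
move=> [mg [M gM]] [mh [N hN]]; split; first exact: measurable_funD.
by exists (M + N) => x; rewrite (le_trans (ler_normD _ _))// lerD.
Qed.

Lemma bmfB g h : bmf g -> bmf h -> bmf (fun x => g x - h x).
Proof.
move=> [mg [M gM]] [mh [N hN]]; split; first exact: measurable_funB.
by exists (M + N) => x; rewrite (le_trans (ler_normB _ _))// lerD.
Qed.

Lemma bmfM g h : bmf g -> bmf h -> bmf (fun x => g x * h x).
Proof.
move=> [mg [M gM]] [mh [N hN]]; split; first exact: measurable_funM.
by exists (M * N) => x; rewrite normrM ler_pM.
Qed.

Lemma bmfX n g : bmf g -> bmf (fun x => g x ^+ n).
Proof.
move=> bg; elim: n => [|n IH].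
  by under [X in bmf X]eq_fun do rewrite expr0; exact: bmf_cst.
by under [X in bmf X]eq_fun do rewrite exprS; exact: bmfM.
Qed.

Lemma bmf_norm g : bmf g -> bmf (fun x => `|g x|).
Proof.
move=> [mg [M gM]]; split; first exact: measurableT_comp.
by exists M => x; rewrite normr_id.
Qed.

Lemma bmf_max g h : bmf g -> bmf h -> bmf (fun x => Num.max (g x) (h x)).
Proof.
move=> [mg [M gM]] [mh [N hN]]; split; first exact: measurable_maxr.
exists (Num.max M N) => x.
by rewrite le_max; case: (leP (g x)) => _; rewrite ?gM ?hN ?orbT.
Qed.

Lemma bmf_expR g : bmf g -> bmf (fun x => expR (g x)).
Proof.
move=> [mg [M gM]]; split; first exact: measurableT_comp.
exists (expR M) => x; rewrite ger0_norm ?expR_ge0// ler_expR.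
exact: le_trans (ler_norm _) (gM x).
Qed.

Lemma bmf_comp {d'} {T' : measurableType d'} (k : T' -> T) g :
  measurable_fun [set: T'] k -> bmf g -> bmf (fun x => g (k x)).
Proof.
by move=> mk [mg [M gM]]; split; [exact: measurableT_comp|exists M].
Qed.

End closure.

Section integral.
Context {d} {T : measurableType d} (m : probability T R).
Implicit Types g h : T -> R.

Lemma bmf_integrable h : bmf h -> m.-integrable setT (EFin \o h).
Proof.
move=> [mh [M hM]]; apply: measurable_bounded_integrable => //.
  by rewrite ltey_eq fin_num_measure.
exists M; split; first exact: num_real.
by move=> x Mx y _; exact: le_trans (hM y) (ltW Mx).
Qed.

Lemma EFin_bmf_Rintegral h : bmf h ->
  (\int[m]_x (h x)%:E = (\int[m]_x h x)%:E)%E.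
Proof.
by move=> bh; rewrite /Rintegral fineK//; exact/integrable_fin_num/bmf_integrable.
Qed.

Lemma bmf_RintegralD g h : bmf g -> bmf h ->
  \int[m]_x (g x + h x) = \int[m]_x g x + \int[m]_x h x.
Proof. by move=> bg bh; rewrite RintegralD//; exact: bmf_integrable. Qed.

Lemma bmf_RintegralB g h : bmf g -> bmf h ->
  \int[m]_x (g x - h x) = \int[m]_x g x - \int[m]_x h x.
Proof. by move=> bg bh; rewrite RintegralB//; exact: bmf_integrable. Qed.

Lemma bmf_RintegralZ c h : bmf h ->
  \int[m]_x (c * h x) = c * \int[m]_x h x.
Proof. by move=> bh; rewrite RintegralZl//; exact: bmf_integrable. Qed.

Lemma probability_Rintegral_cst c : \int[m]_x c = c.
Proof.
rewrite Rintegral_cst//; have := probability_setT m; rewrite /= => ->.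
by rewrite mulr1.
Qed.

Lemma bmf_le_Rintegral g h : bmf g -> bmf h -> (forall x, g x <= h x) ->
  \int[m]_x g x <= \int[m]_x h x.
Proof. by move=> bg bh gh; apply: le_Rintegral => //; exact: bmf_integrable. Qed.

Lemma bmf_le_norm_Rintegral h : bmf h ->
  `|\int[m]_x h x| <= \int[m]_x `|h x|.
Proof. by move=> bh; apply: le_normr_Rintegral => //; exact: bmf_integrable. Qed.

Lemma bmf_norm_Rintegral_le h c : bmf h -> (forall x, `|h x| <= c) ->
  `|\int[m]_x h x| <= c.
Proof.
move=> bh hc; apply: le_trans (bmf_le_norm_Rintegral bh) _.
rewrite -[leRHS]probability_Rintegral_cst; apply: bmf_le_Rintegral => //.
  exact: bmf_norm.
exact: bmf_cst.
Qed.

(* Jensen: integrate [(h - c)^2 >= 0] for [c = \int h]. *)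
Lemma bmf_sqr_Rintegral_le h : bmf h ->
  (\int[m]_x h x) ^+ 2 <= \int[m]_x (h x ^+ 2).
Proof.
move=> bh; set c := \int[m]_x h x.
have : 0 <= \int[m]_x (h x ^+ 2 - (2 * c * h x - c ^+ 2)).
  apply: Rintegral_ge0 => x _.
  by rewrite (_ : _ - _ = (h x - c) ^+ 2) ?sqr_ge0//; ring.
have b2 : bmf (fun x => 2 * c * h x) by apply: bmfM => //; exact: bmf_cst.
have bc : bmf (fun x : T => c ^+ 2) by exact: bmf_cst.
rewrite bmf_RintegralB//; [|exact: bmfX|exact: bmfB].
rewrite bmf_RintegralB// bmf_RintegralZ// probability_Rintegral_cst -/c.
by rewrite subr_ge0 (_ : _ - _ = c ^+ 2)//; ring.
Qed.

End integral.

Section fubini.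
Context {d1 d2} {T1 : measurableType d1} {T2 : measurableType d2}
  (m1 : probability T1 R) (m2 : probability T2 R).

Lemma bmf_section1 (h : T1 * T2 -> R) x : bmf h -> bmf (fun y => h (x, y)).
Proof. by apply: bmf_comp; exact: measurable_pair1. Qed.

Lemma bmf_section2 (h : T1 * T2 -> R) y : bmf h -> bmf (fun x => h (x, y)).
Proof. by apply: bmf_comp; exact: measurable_pair2. Qed.

Lemma bmf_Rintegral1 (h : T1 * T2 -> R) : bmf h ->
  bmf (fun x => \int[m2]_y h (x, y)).
Proof.
move=> bh; have [mh [M hM]] := bh; split; last first.
  exists M => x; apply: bmf_norm_Rintegral_le => [|y //].
  exact: bmf_section1.
apply/measurable_EFinP.
rewrite (_ : EFin \o _ = fubini_F m2 (EFin \o h)); last first.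
  apply/funext => x; rewrite /fubini_F/= -EFin_bmf_Rintegral//.
  exact: bmf_section1.
exact/(measurable_fubini_F (m1 := m1))/(bmf_integrable (m1 \x m2)%E).
Qed.

Lemma bmf_Rintegral2 (h : T1 * T2 -> R) : bmf h ->
  bmf (fun y => \int[m1]_x h (x, y)).
Proof.
move=> bh; have [mh [M hM]] := bh; split; last first.
  exists M => x; apply: bmf_norm_Rintegral_le => [|y //].
  exact: bmf_section2.
apply/measurable_EFinP.
rewrite (_ : EFin \o _ = fubini_G m1 (EFin \o h)); last first.
  apply/funext => x; rewrite /fubini_G/= -EFin_bmf_Rintegral//.
  exact: bmf_section2.
exact/(measurable_fubini_G (m2 := m2))/(bmf_integrable (m1 \x m2)%E).
Qed.

Lemma bmf_fubini1 (h : T1 * T2 -> R) : bmf h ->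
  \int[m1]_x \int[m2]_y h (x, y) = \int[(m1 \x m2)%E]_p h p.
Proof.
move=> bh; rewrite [RHS]/Rintegral -integral12_prod_meas1; last first.
  exact: (bmf_integrable (m1 \x m2)%E).
rewrite /fubini_F; congr fine; apply: eq_integral => x _ /=.
by rewrite EFin_bmf_Rintegral//; exact: bmf_section1.
Qed.

Lemma bmf_fubini2 (h : T1 * T2 -> R) : bmf h ->
  \int[m2]_y \int[m1]_x h (x, y) = \int[(m1 \x m2)%E]_p h p.
Proof.
move=> bh; rewrite [RHS]/Rintegral -integral21_prod_meas1; last first.
  exact: (bmf_integrable (m1 \x m2)%E).
rewrite /fubini_G; congr fine; apply: eq_integral => x _ /=.
by rewrite EFin_bmf_Rintegral//; exact: bmf_section2.
Qed.

End fubini.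
End bounded_measurable.

(** * Real inequalities: the exponential, the mixing sum, a discrete Gronwall lemma *)

Section real_lemmas.
Context {R : realType}.
Implicit Types x y b l c t : R.

Lemma eq_ler x y : x = y -> x <= y.
Proof. by move=> ->. Qed.

(** Trapezoid rule for the convex function exp. Dividing by [expR x] leaves [k 0 <= k d] with
    [d = y - x], and [k] is nondecreasing because [1 - z <= exp(-z)]. *)
Lemma expR_sub_le x y : x <= y ->
  expR y - expR x <= 2^-1 * (y - x) * (expR x + expR y).
Proof.
pose k (d : R) := 2^-1 * d + (2^-1 * d - 1) * expR d.
have dk (z : R) : is_derive z 1 k (2^-1 + (2^-1 + (2^-1 * z - 1)) * expR z).
  by apply: is_derive_eq; rewrite /GRing.scale/=; ring.
rewrite -subr_ge0 -[in expR y](subrK x y); move: (y - x) => d d0.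
suff k0 : k 0 <= k d.
  move: k0; rewrite /k mulr0 expR0 mulr1 expRD => k0.
  have := ler_wpM2r (expR_ge0 x) k0.
  by rewrite -subr_ge0 => h; rewrite -subr_ge0; apply: le_trans h _; apply: eq_ler; ring.
apply: (@ger0_derive1_le_cc _ k 0 d) => //.
- move=> z; rewrite in_itv/= => /andP[z0 _].
  rewrite derive1E derive_val.
  have := expR_ge1Dx (- z); rewrite expRN => h.
  have := ler_wpM2r (expR_ge0 z) h; rewrite mulVf ?gt_eqF ?expR_gt0//.
  by lra.
- apply: continuous_subspaceT => z.
  by apply/differentiable_continuous/derivable1_diffP.
- by rewrite in_itv/= lexx.
- by rewrite in_itv/= lexx andbT.
Qed.

Lemma expR_lipschitz x y :
  `|expR x - expR y| <= 2^-1 * `|x - y| * (expR x + expR y).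
Proof.
wlog xy : x y / x <= y => [H|].
  have [/H//|/ltW/H] := leP x y.
  by rewrite distrC (distrC y) (addrC (expR y)).
rewrite distrC (distrC x) ger0_norm ?subr_ge0 ?ler_expR// ger0_norm ?subr_ge0//.
exact: expR_sub_le.
Qed.

(** Removing the first term lowers [l] by [b]. While [l >= b] that term costs at most 1, paid by the
    decrease of [l / b]; what remains is a geometric series. *)
Lemma sum_min_expR_le b l n : 0 < b -> 0 <= l ->
  \sum_(k < n) Num.min 1 (expR (l - b * k%:R)) <= l / b + (1 - expR (- b))^-1.
Proof.
move=> b0.
pose r := expR (- b); have r1 : 0 < 1 - r by rewrite subr_gt0 expR_lt1 oppr_lt0.
have K0 : 0 <= (1 - r)^-1 by rewrite invr_ge0 ltW.
have K1 : (1 - r)^-1 = 1 + r * (1 - r)^-1.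
  by field; rewrite gt_eqF.
have shift (m : nat) (z : R) : \sum_(k < m.+1) Num.min 1 (expR (z - b * k%:R)) =
    Num.min 1 (expR z) + \sum_(k < m) Num.min 1 (expR ((z - b) - b * k%:R)).
  rewrite big_ord_recl mulr0 subr0; congr (_ + _); apply: eq_bigr => i _.
  by rewrite -[in LHS]natr1 mulrDr mulr1 opprD addrA (addrAC z).
(* below level 0 the sum is dominated by the geometric series *)
have neg (m : nat) (z : R) : z <= 0 ->
    \sum_(k < m) Num.min 1 (expR (z - b * k%:R)) <= expR z * (1 - r)^-1.
  elim: m z => [|m IH] z z0; first by rewrite big_ord0 mulr_ge0// expR_ge0.
  rewrite shift; apply: (@le_trans _ _ (expR z + expR (z - b) * (1 - r)^-1)).
    rewrite lerD//; first by rewrite ge_min lexx orbT.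
    by apply: IH; rewrite subr_le0 (le_trans z0)// ltW.
  by rewrite expRD -/r [X in _ <= expR z * X]K1; lra.
elim: n l => [|n IH] l l0; first by rewrite big_ord0 addr_ge0// divr_ge0// ltW.
rewrite shift.
have h1 : Num.min 1 (expR l) <= 1 by rewrite ge_min lexx.
have [bl|/ltW lb] := leP b l.
  have := IH (l - b); rewrite subr_ge0 => /(_ bl) h2.
  rewrite (_ : l / b = 1 + (l - b) / b); first by lra.
  by field; rewrite gt_eqF.
have lb0 : 0 <= l / b by rewrite divr_ge0// ltW.
have lb1 : l / b <= 1 by rewrite ler_pdivrMr// mul1r.
(* At the last level, where [l <= b], the chord of exp over [[-b, 0]] interpolates, so that [l / b]
   is not rounded up. *)
have h2 : expR (l - b) <= (1 - l / b) * r + l / b.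
  have := convex_expR (Itv01 lb0 lb1) (0 : R^o) (- b : R^o).
  rewrite !convRE/= /unstable.onem expR0 mulr0 add0r mulr1 -/r.
  rewrite (_ : (1 - l / b) * - b = l - b); last by field; rewrite gt_eqF.
  by rewrite [X in _ <= X]addrC.
have h3 := @neg n (l - b); rewrite subr_le0 in h3.
have h4 : expR (l - b) * (1 - r)^-1 <= ((1 - l / b) * r + l / b) * (1 - r)^-1.
  exact: ler_wpM2r.
have h5 : ((1 - l / b) * r + l / b) * (1 - r)^-1 = l / b - 1 + (1 - r)^-1.
  by field; rewrite !gt_eqF.
have := h3 lb.
by lra.
Qed.

(** Discrete Gronwall lemma: the tangent hypothesis stands for [m' <= c y m]. With the integrating
    factor, [g] loses at most a factor [1 - K d^2] over a step of length [d], and over finer and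
    finer subdivisions of [[0, t]] these factors multiply to 1 in the limit. *)
Lemma le_exp_of_tangent (m : R -> R) c t : 0 <= c -> 0 <= t -> m 0 = 1 ->
  (forall x, 0 < m x) ->
  (forall x y, 0 <= x -> x <= y -> m y * (1 - (y - x) * y * c) <= m x) ->
  m t <= expR (c * t ^+ 2 / 2).
Proof.
move=> c0 t0 m0 mp mt.
pose g x := m x * expR (- (c * x ^+ 2 / 2)).
(* In [(1 + e) (1 - (y - x) y c)], the part [c / 2] comes from the gap between [c (y - x) y] and the
   increment [e] of [c x^2 / 2]; [c^2 t^2] bounds the cross term. *)
pose K := c / 2 + c ^+ 2 * t ^+ 2.
have K0 : 0 <= K by rewrite addr_ge0// ?divr_ge0// mulr_ge0// sqr_ge0.
have g0 x : 0 <= g x by rewrite mulr_ge0 ?expR_ge0// ltW.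
have gstep x y : 0 <= x -> x <= y -> y <= t -> g y * (1 - K * (y - x) ^+ 2) <= g x.
  move=> x0 xy yt.
  have y0 := le_trans x0 xy.
  set e := c * (y ^+ 2 - x ^+ 2) / 2.
  have e0 : 0 <= e by rewrite divr_ge0// mulr_ge0// subr_ge0 ler_sqr.
  have [neg|pos] := leP (1 - (y - x) * y * c) 0.
    have : 1 - K * (y - x) ^+ 2 <= 0; last first.
      by move=> h; apply: le_trans (g0 x); rewrite mulr_ge0_le0.
    have h1 : 1 <= (y - x) * y * c by lra.
    have h2 : 1 <= ((y - x) * y * c) ^+ 2 by rewrite exprn_ege1.
    have h3 : ((y - x) * y * c) ^+ 2 <= c ^+ 2 * t ^+ 2 * (y - x) ^+ 2.
      rewrite !exprMn mulrC [X in _ <= X]mulrAC mulrA; apply: ler_wpM2l.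
        by rewrite mulr_ge0// sqr_ge0.
      by rewrite ler_sqr// nnegrE (le_trans y0).
    have h4 : 0 <= c / 2 * (y - x) ^+ 2 by rewrite mulr_ge0 ?divr_ge0// sqr_ge0.
    by rewrite /K; lra.
  have h : 1 - K * (y - x) ^+ 2 <= expR e * (1 - (y - x) * y * c).
    apply: (@le_trans _ _ ((1 + e) * (1 - (y - x) * y * c))); last first.
      by rewrite ler_wpM2r ?expR_ge1Dx// ltW.
    rewrite -subr_ge0 (_ : _ - _ = c ^+ 2 * (y - x) ^+ 2 * (t ^+ 2 - y ^+ 2) +
        c ^+ 2 * (y - x) ^+ 2 * ((y - x) * y / 2)); last by rewrite /e /K; field.
    rewrite addr_ge0// mulr_ge0//; do ?[by rewrite mulr_ge0// sqr_ge0].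
      by rewrite subr_ge0 ler_sqr// nnegrE (le_trans y0).
    by rewrite divr_ge0// mulr_ge0// subr_ge0.
  apply: (@le_trans _ _ (g y * (expR e * (1 - (y - x) * y * c)))).
    by rewrite ler_wpM2l.
  have := ler_wpM2r (expR_ge0 (- (c * x ^+ 2 / 2))) (mt _ _ x0 xy).
  rewrite -/(g x); apply: le_trans.
  rewrite /g (_ : - (c * x ^+ 2 / 2) = - (c * y ^+ 2 / 2) + e).
    by rewrite expRD; apply: eq_ler; ring.
  by rewrite /e; field.
suff gt1 : g t <= 1.
  by rewrite -[leRHS]mul1r -ler_pdivrMr ?expR_gt0// -expRN.
have bern (n : nat) : K * t ^+ 2 / n.+1%:R <= 1 -> g t * (1 - K * t ^+ 2 / n.+1%:R) <= 1.
  move=> hn.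
  pose q := 1 - K * (t / n.+1%:R) ^+ 2.
  have nn0 : 0 < n.+1%:R :> R by rewrite ltr0n.
  have nn1 : 1 <= n.+1%:R :> R by rewrite ler1n.
  have Eq : K * (t / n.+1%:R) ^+ 2 = (K * t ^+ 2 / n.+1%:R) / n.+1%:R.
    by field; rewrite gt_eqF.
  have q0 : 0 <= q.
    rewrite /q Eq subr_ge0 ler_pdivrMr// mul1r.
    exact: le_trans nn1.
  have iter (j : nat) : (j <= n.+1)%N -> g (t / n.+1%:R * j%:R) * q ^+ j <= 1.
    elim: j => [_|j IH jn].
      by rewrite mulr0 expr0 mulr1 /g m0 expr0n/= mulr0 mul0r oppr0 expR0 mulr1.
    apply: le_trans (IH (ltnW jn)); rewrite exprS mulrA.
    apply: ler_wpM2r; first exact: exprn_ge0.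
    have tn0 : 0 <= t / n.+1%:R by rewrite divr_ge0.
    have := gstep (t / n.+1%:R * j%:R) (t / n.+1%:R * j.+1%:R).
    rewrite (_ : t / n.+1%:R * j.+1%:R - t / n.+1%:R * j%:R = t / n.+1%:R); last first.
      by rewrite -natr1; ring.
    apply.
    - by rewrite mulr_ge0.
    - by rewrite ler_wpM2l// ler_nat.
    - by rewrite mulrAC ler_pdivrMr// ler_wpM2l// ler_nat.
  have := iter n.+1 (leqnn _); rewrite divfK ?gt_eqF//.
  apply: le_trans; apply: ler_wpM2l => //.
  have bernoulli (j : nat) : 1 - j%:R * (1 - q) <= q ^+ j.
    elim: j => [|j IH]; first by rewrite mul0r subr0 expr0.
    have q1 : q <= 1 by rewrite gerBl mulr_ge0// sqr_ge0.
    rewrite exprS; apply: le_trans (ler_wpM2l q0 IH).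
    rewrite -natr1 -subr_ge0 (_ : _ - _ = j%:R * (1 - q) ^+ 2); last by ring.
    by rewrite mulr_ge0// sqr_ge0.
  apply: le_trans (bernoulli _).
  apply: eq_ler; rewrite /q.
  by move: (n.+1%:R : R) nn0 => N N0; field; rewrite gt_eqF.
apply/ler_addgt0Pl => e e0.
(* Any [n.+1 > W] makes [K t^2 / n.+1] at most 1 and its product with [g t] at most [e]. *)
pose W := K * t ^+ 2 * (1 + g t / e).
have gte : 0 <= g t / e by rewrite divr_ge0// ltW.
have W0 : 0 <= K * t ^+ 2 by rewrite mulr_ge0// sqr_ge0.
pose n := Num.bound W.
have hW : W < n.+1%:R.
  apply: lt_trans (archi_boundP _) _; first by rewrite mulr_ge0// addr_ge0.
  by rewrite ltr_nat.
have nn0 : 0 < n.+1%:R :> R by rewrite ltr0n.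
have h1 : K * t ^+ 2 / n.+1%:R <= 1.
  rewrite ler_pdivrMr// mul1r; apply: le_trans (ltW hW).
  by rewrite /W mulrDr mulr1 lerDl mulr_ge0.
have h2 : g t * (K * t ^+ 2 / n.+1%:R) <= e.
  rewrite mulrA ler_pdivrMr//; apply: le_trans (ler_wpM2l (ltW e0) (ltW hW)).
  rewrite (_ : e * W = e * (K * t ^+ 2) + g t * (K * t ^+ 2)).
    by rewrite lerDr mulr_ge0// ltW.
  by rewrite /W; field; rewrite gt_eqF.
have := bern n h1; rewrite mulrBr mulr1 => /lerD/(_ h2).
by rewrite subrK addrC.
Qed.

End real_lemmas.

(** * Random walk with step law [nu] and invariant law [mu] *)

Section random_walk.
Context {R : realType} {d} {T : measurableType d}.
Variables (mul : T -> T -> T) (inv : T -> T) (mu nu : probability T R).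
Hypothesis mulA : associative mul.
Hypothesis mulKV : forall x y, mul y (mul (inv y) x) = x.
Hypothesis mmul : measurable_fun [set: T * T] (fun p => mul p.1 p.2).
Hypothesis mu_inv : forall x (h : T -> R), bmf h ->
  \int[mu]_y h (mul x y) = \int[mu]_y h y.
Hypothesis nu_sym : forall h : T -> R, bmf h ->
  \int[nu]_y h (inv y) = \int[nu]_y h y.
Hypothesis nu_conj : forall y (h : T -> R), bmf h ->
  \int[nu]_z h (mul z y) = \int[nu]_z h (mul y z).

Definition step (h : T -> R) : T -> R := fun x => \int[nu]_y h (mul y x).

(** The square of [||h||_Y] before the supremum over [x], kept as a function so that it can be
    bounded almost everywhere. *)
Definition step_var (h : T -> R) : T -> R :=
  fun x => \int[nu]_y ((h x - h (mul y x)) ^+ 2).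

Let mmul2 d' (T' : measurableType d') (k l : T' -> T) :
  measurable_fun setT k -> measurable_fun setT l ->
  measurable_fun setT (fun x => mul (k x) (l x)).
Proof.
by move=> mk ml; apply: (measurableT_comp mmul (measurable_fun_pair mk ml)).
Qed.

Lemma bmf_mul d' (T' : measurableType d') (k l : T' -> T) (h : T -> R) :
  measurable_fun setT k -> measurable_fun setT l -> bmf h ->
  bmf (fun x => h (mul (k x) (l x))).
Proof. by move=> mk ml; apply: bmf_comp; exact: mmul2. Qed.

Lemma bmf_mull y (h : T -> R) : bmf h -> bmf (fun x => h (mul y x)).
Proof. by apply: bmf_mul. Qed.

Lemma bmf_mulr y (h : T -> R) : bmf h -> bmf (fun x => h (mul x y)).
Proof. by apply: bmf_mul. Qed.

Let bmf_mul21 (h : T -> R) : bmf h -> bmf (fun p : T * T => h (mul p.2 p.1)).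
Proof. by apply: bmf_mul. Qed.

Lemma bmf_step h : bmf h -> bmf (step h).
Proof.
move=> bh; apply: (bmf_Rintegral1 mu nu (h := fun p => h (mul p.2 p.1))).
exact: bmf_mul21.
Qed.

Lemma bmf_pair (h : T * T -> R) : bmf h -> bmf (fun p : T * T => h (p.1, mul p.2 p.1)).
Proof.
apply: bmf_comp; apply: measurable_fun_pair => //; exact: mmul2.
Qed.

Lemma bmf_step_var h : bmf h -> bmf (step_var h).
Proof.
move=> bh; apply: (bmf_Rintegral1 mu nu (h := fun p => (h p.1 - h (mul p.2 p.1)) ^+ 2)).
by apply/bmfX/bmfB; [exact: bmf_comp|exact: bmf_mul21].
Qed.

Lemma Rintegral_mu_step h : bmf h -> \int[mu]_x step h x = \int[mu]_x h x.
Proof.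
move=> bh; rewrite /step.
rewrite (bmf_fubini1 mu nu (h := fun p => h (mul p.2 p.1))); last exact: bmf_mul21.
rewrite -bmf_fubini2; last exact: bmf_mul21.
under eq_Rintegral do rewrite mu_inv//.
by rewrite probability_Rintegral_cst.
Qed.

(* Translate the integral over mu by [inv y], then use the symmetry of nu. *)
Lemma exchangeable (h : T * T -> R) : bmf h ->
  \int[(mu \x nu)%E]_p h (p.1, mul p.2 p.1) =
  \int[(mu \x nu)%E]_p h (mul p.2 p.1, p.1).
Proof.
move=> bh.
have b1 := bmf_pair bh.
have b2 : bmf (fun p : T * T => h (mul p.2 p.1, p.1)).
  by apply: bmf_comp bh; apply: measurable_fun_pair => //; exact: mmul2.
rewrite -(bmf_fubini2 mu nu b1) -(bmf_fubini2 mu nu b2)/=.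
rewrite -[RHS]nu_sym; last exact: (bmf_Rintegral2 mu nu b2).
apply: eq_Rintegral => y _.
rewrite -(mu_inv (inv y)); last exact: (bmf_section2 y b1).
by under eq_Rintegral do rewrite mulKV.
Qed.

(* Conjugation invariance of nu makes [step h x - step h (y x)] an average over
   z of [h (z x) - h (y (z x))]. *)
Lemma step_var_step_le h x : bmf h ->
  step_var (step h) x <= step (step_var h) x.
Proof.
move=> bh.
have bq : bmf (fun p : T * T => (h (mul p.2 x) - h (mul p.1 (mul p.2 x))) ^+ 2).
  apply/bmfX/bmfB; first exact: bmf_mul.
  by apply: bmf_mul => //; exact: mmul2.
have := bmf_fubini2 nu nu bq; rewrite -bmf_fubini1//= => E.
rewrite [leRHS]E.
apply: bmf_le_Rintegral => [| |y].
- apply/bmfX/bmfB; first exact: bmf_cst.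
  by apply: bmf_mulr; exact: bmf_step.
- exact: (bmf_Rintegral1 nu nu bq).
- rewrite (_ : step h x - _ = \int[nu]_z (h (mul z x) - h (mul y (mul z x)))).
    apply: bmf_sqr_Rintegral_le; apply: bmfB; first exact: bmf_mulr.
    by apply: bmf_mul => //; exact: mmul2.
  rewrite bmf_RintegralB; [|exact: bmf_mulr|by apply: bmf_mul => //; exact: mmul2].
  congr (_ - _); rewrite /step.
  under eq_Rintegral do rewrite mulA.
  rewrite [LHS](nu_conj y (bmf_mulr x bh)).
  by under eq_Rintegral do rewrite -mulA.
Qed.

(* For bounded measurable [h], this says that [h <= c] mu-almost everywhere. *)
Definition ess_le (h : T -> R) c := \int[mu]_x Num.max (h x - c) 0 = 0.

Lemma bmf_excess (h : T -> R) c : bmf h -> bmf (fun x => Num.max (h x - c) 0).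
Proof. by move=> bh; apply: bmf_max; [apply: bmfB|]; rewrite //; exact: bmf_cst. Qed.

Lemma le_ess_le (h : T -> R) c : (forall x, h x <= c) -> ess_le h c.
Proof.
move=> hc; rewrite /ess_le -[RHS](probability_Rintegral_cst mu).
by apply: eq_Rintegral => x _; apply/max_idPr; rewrite subr_le0.
Qed.

(** By [step_var_step_le] and convexity of the positive part, the excess of [step_var (step h)] over
    [c] is at most [step] of the excess of [step_var h], whose integral is 0 since [mu] is
    stationary. *)
Lemma ess_le_step_var h c : bmf h -> ess_le (step_var h) c ->
  ess_le (step_var (step h)) c.
Proof.
move=> bh hc; apply/eqP; rewrite eq_le Rintegral_ge0 ?andbT; last first.
  by move=> x _; rewrite le_max lexx orbT.
have bD := bmf_step_var bh.
rewrite -{2}hc -(Rintegral_mu_step (bmf_excess c bD)).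
apply: bmf_le_Rintegral => [| |x].
- by apply/bmf_excess/bmf_step_var/bmf_step.
- by apply/bmf_step/bmf_excess.
- rewrite ge_max [X in _ && X]Rintegral_ge0 ?andbT; last first.
    by move=> y _; rewrite le_max lexx orbT.
  apply: (@le_trans _ _ (step (step_var h) x - c)).
    by rewrite lerB// step_var_step_le.
  have -> : step (step_var h) x - c = \int[nu]_y (step_var h (mul y x) - c).
    rewrite bmf_RintegralB ?probability_Rintegral_cst//; first exact: bmf_mulr.
    exact: bmf_cst.
  apply: bmf_le_Rintegral => [| |y].
  + by apply: bmfB; [exact: bmf_mulr|exact: bmf_cst].
  + exact: (bmf_mulr x (bmf_excess c bD)).
  + by rewrite le_max lexx.
Qed.

(** Pointwise [w h <= c w + M (h - c)^+] where [M] bounds [w], and the last term integrates to 0. *)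
Lemma ess_le_Rintegral (h : T -> R) c (w : T -> R) : bmf h -> bmf w -> (forall x, 0 <= w x) ->
  ess_le h c -> \int[mu]_x (w x * h x) <= c * \int[mu]_x w x.
Proof.
move=> bh bw w0 hc; have [_ [M wM]] := bw.
have be := bmf_excess c bh.
rewrite -[leRHS]addr0 -(mulr0 M) -hc -!bmf_RintegralZ//.
rewrite -bmf_RintegralD; last 2 first.
- by apply: bmfM => //; exact: bmf_cst.
- by apply: bmfM => //; exact: bmf_cst.
apply: bmf_le_Rintegral => [| |x].
- exact: bmfM.
- by apply: bmfD; apply: bmfM => //; exact: bmf_cst.
rewrite -lerBlDl (mulrC c) -mulrBr.
apply: (@le_trans _ _ (w x * Num.max (h x - c) 0)).
  by rewrite ler_wpM2l// le_max lexx.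
rewrite ler_wpM2r ?le_max ?lexx ?orbT//.
exact: le_trans (ler_norm _) (wM x).
Qed.

(** One term of the telescoping sum. Exchangeability makes the two weights [w x] and [w x']
    contribute equally, which absorbs the factor one half. The hypothesis on [u] covers both [u = f]
    with [w = 1] and [u = w = exp(t f)]. *)
Lemma Rintegral_step_increment (u w f h : T -> R) k c e : bmf u -> bmf w -> bmf f -> bmf h ->
  (forall x, 0 <= w x) -> 0 <= k -> 0 < c -> 0 < e ->
  (forall x x', `|u x - u x'| <= k * `|f x - f x'| * (w x + w x')) ->
  ess_le (step_var f) (c ^+ 2) -> ess_le (step_var h) (e ^+ 2) ->
  `|\int[mu]_x (u x * (h x - step h x))| <= k * c * e * \int[mu]_x w x.
Proof.
move=> bu bw bf bh w0 k0 c0 e0 ulip fc he.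
pose pm : probability (T * T)%type R := (mu \x nu)%E.
have b1 g : bmf g -> bmf (fun p : T * T => g p.1) by apply: bmf_comp.
have b2 g : bmf g -> bmf (fun p : T * T => g p.2) by apply: bmf_comp.
have b21 := bmf_mul21.
have bdf : bmf (fun p : T * T => `|f p.1 - f (mul p.2 p.1)|).
  by apply/bmf_norm/bmfB; [exact: b1|exact: b21].
have bdh : bmf (fun p : T * T => `|h p.1 - h (mul p.2 p.1)|).
  by apply/bmf_norm/bmfB; [exact: b1|exact: b21].
have bduh : bmf (fun p : T * T => (u p.1 - u (mul p.2 p.1)) * (h p.1 - h (mul p.2 p.1))).
  by apply: bmfM; apply: bmfB; do ?[exact: b1|exact: b21].
have bwfh : bmf (fun p : T * T => w p.1 *
    (`|f p.1 - f (mul p.2 p.1)| * `|h p.1 - h (mul p.2 p.1)|)).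
  by apply: bmfM; [exact: b1|exact: bmfM].
have bwfh' : bmf (fun p : T * T => w (mul p.2 p.1) *
    (`|f p.1 - f (mul p.2 p.1)| * `|h p.1 - h (mul p.2 p.1)|)).
  by apply: bmfM; [exact: b21|exact: bmfM].
have E1 : \int[mu]_x (u x * (h x - step h x)) =
    \int[pm]_p (u p.1 * (h p.1 - h (mul p.2 p.1))).
  rewrite -(bmf_fubini1 mu nu (h := fun p => u p.1 * (h p.1 - h (mul p.2 p.1)))).
    apply: eq_Rintegral => x _ /=; rewrite bmf_RintegralZ//.
      rewrite bmf_RintegralB ?probability_Rintegral_cst//; first exact: bmf_cst.
      exact: bmf_mulr.
    by apply: bmfB; [exact: bmf_cst|exact: bmf_mulr].
  by apply: bmfM; [exact: b1|apply: bmfB; [exact: b1|exact: b21]].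
have E2 : \int[mu]_x (u x * (h x - step h x)) *+ 2 =
    \int[pm]_p ((u p.1 - u (mul p.2 p.1)) * (h p.1 - h (mul p.2 p.1))).
  have E1' : \int[mu]_x (u x * (h x - step h x)) =
      \int[pm]_p (u (mul p.2 p.1) * (h (mul p.2 p.1) - h p.1)).
    rewrite E1; apply: (exchangeable (h := fun p => u p.1 * (h p.1 - h p.2))).
    by apply: bmfM; [exact: b1|apply: bmfB; [exact: b1|exact: b2]].
  rewrite mulr2n {1}E1 E1'.
  rewrite -bmf_RintegralD; first by apply: eq_Rintegral => p _ /=; ring.
    by apply: bmfM; [exact: b1|apply: bmfB; [exact: b1|exact: b21]].
  by apply: bmfM; [exact: b21|apply: bmfB; [exact: b21|exact: b1]].
have E3 : \int[pm]_p (w (mul p.2 p.1) *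
    (`|f p.1 - f (mul p.2 p.1)| * `|h p.1 - h (mul p.2 p.1)|)) =
    \int[pm]_p (w p.1 * (`|f p.1 - f (mul p.2 p.1)| * `|h p.1 - h (mul p.2 p.1)|)).
  rewrite (exchangeable (h := fun p => w p.1 * (`|f p.1 - f p.2| * `|h p.1 - h p.2|))).
    by apply: eq_Rintegral => p _; rewrite (distrC (f _)) (distrC (h _)).
  apply: bmfM; first exact: b1.
  by apply: bmfM; apply/bmf_norm/bmfB; do ?[exact: b1|exact: b2].
have E4 : `|\int[mu]_x (u x * (h x - step h x)) *+ 2| <=
    k * \int[pm]_p (w p.1 * (`|f p.1 - f (mul p.2 p.1)| * `|h p.1 - h (mul p.2 p.1)|)) *+ 2.
  rewrite E2 -mulrnAr mulr2n -{2}E3 -bmf_RintegralD// -bmf_RintegralZ//; last exact: bmfD.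
  apply: le_trans (bmf_le_norm_Rintegral _ bduh) _.
  apply: bmf_le_Rintegral => [| |p]; first exact: bmf_norm.
    by apply: bmfM; [exact: bmf_cst|exact: bmfD].
  rewrite normrM -mulrDl.
  apply: le_trans (ler_wpM2r (normr_ge0 _) (ulip _ _)) _.
  by apply: eq_ler; ring.
have {}E4 : `|\int[mu]_x (u x * (h x - step h x))| <=
    k * \int[pm]_p (w p.1 * (`|f p.1 - f (mul p.2 p.1)| * `|h p.1 - h (mul p.2 p.1)|)).
  by move: E4; rewrite normrMn lerMn2r.
apply: le_trans E4 _; rewrite -!mulrA; apply: ler_wpM2l => //.
have bDf := bmf_step_var bf; have bDh := bmf_step_var bh.
(* Balanced weights: [s c^2] and [r e^2] both equal [c e / 2]. *)
pose s := e / c / 2; pose r := c / e / 2.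
have s0 : 0 <= s by rewrite /s !divr_ge0// ltW.
have r0 : 0 <= r by rewrite /r !divr_ge0// ltW.
(* AM-GM: |a b| <= s a^2 + r b^2, as 4 s r = 1 *)
apply: (@le_trans _ _ (\int[mu]_x (s * (w x * step_var f x) + r * (w x * step_var h x)))).
  rewrite -(bmf_fubini1 mu nu bwfh); apply: bmf_le_Rintegral => [| |x].
  - exact: (bmf_Rintegral1 mu nu bwfh).
  - by apply: bmfD; (apply: bmfM; [exact: bmf_cst|exact: bmfM]).
  rewrite /= bmf_RintegralZ; last exact: (bmf_section1 x (bmfM bdf bdh)).
  rewrite mulrCA (mulrCA r) -mulrDr; apply: ler_wpM2l => //.
  have bf2 : bmf (fun y => (f x - f (mul y x)) ^+ 2).
    by apply/bmfX/bmfB; [exact: bmf_cst|exact: bmf_mulr].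
  have bh2 : bmf (fun y => (h x - h (mul y x)) ^+ 2).
    by apply/bmfX/bmfB; [exact: bmf_cst|exact: bmf_mulr].
  rewrite /step_var -!bmf_RintegralZ// -bmf_RintegralD; last 2 first.
  - by apply: bmfM => //; exact: bmf_cst.
  - by apply: bmfM => //; exact: bmf_cst.
  apply: bmf_le_Rintegral => [| |y].
  - exact: (bmf_section1 x (bmfM bdf bdh)).
  - by apply: bmfD; apply: bmfM => //; exact: bmf_cst.
  rewrite -[X in s * X]real_normK ?num_real// -[X in r * X]real_normK ?num_real//.
  set a := `|f _ - _|; set b := `|h _ - _|.
  have -> : s * a ^+ 2 + r * b ^+ 2 = a * b + (e * a - c * b) ^+ 2 / (2 * c * e).
    by rewrite /s /r; field; rewrite !gt_eqF.
  by rewrite lerDl divr_ge0 ?sqr_ge0// !mulr_ge0// ltW.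
rewrite bmf_RintegralD; last 2 first.
- by apply: bmfM; [exact: bmf_cst|exact: bmfM].
- by apply: bmfM; [exact: bmf_cst|exact: bmfM].
rewrite !bmf_RintegralZ; [|exact: bmfM|exact: bmfM].
apply: le_trans (lerD (ler_wpM2l s0 (ess_le_Rintegral bDf bw w0 fc))
  (ler_wpM2l r0 (ess_le_Rintegral bDh bw w0 he))) _.
by apply: eq_ler; rewrite /s /r; field; rewrite !gt_eqF.
Qed.

(** * Telescoping along the walk: variance, Laplace transform and tails *)

Section concentration.
Variables (f : T -> R) (a b A B : R).
Hypotheses (bf : bmf f) (a0 : 0 < a) (b0 : 0 < b) (A0 : 0 < A) (B0 : 0 < B).
Hypothesis fB : ess_le (step_var f) (B ^+ 2).
Hypothesis decay : forall (k : nat) (x : T), (1 <= k)%N ->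
  `|iter k step f x| <= 2 * A * (a * expR (- (b * k%:R))).

Let L := Num.max (ln (4 * a * A / B)) 0.
Let C := B ^+ 2 / b * (L + b / (1 - expR (- b))).

Let L0 : 0 <= L. Proof. by rewrite /L le_max lexx orbT. Qed.

Let C0 : 0 < C.
Proof.
rewrite mulr_gt0// ?divr_gt0// ?exprn_gt0// ltr_wpDl//.
by rewrite divr_gt0// subr_gt0 expR_lt1 oppr_lt0.
Qed.

Lemma bmf_iter_step k : bmf (iter k step f).
Proof. by elim: k => // k IH; rewrite iterS; exact: bmf_step. Qed.

(** Early on, contraction preserves [B^2]. Once [exp(L - b k) < 1], mixing does better: two values
    of [h_k] differ by at most [4 a A exp(-b k) <= B exp(L - b k)]. *)
Lemma ess_le_step_var_iter k : ess_le (step_var (iter k step f))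
  ((B * Num.min 1 (expR (L - b * k%:R))) ^+ 2).
Proof.
have [Lk|Lk] := leP 1 (expR (L - b * k%:R)).
  rewrite mulr1; elim: k {Lk} => [//|k IH].
  by rewrite iterS; apply: ess_le_step_var => //; exact: bmf_iter_step.
(* Mixing is assumed for [k >= 1]; since [L >= 0], index 0 falls in the first case. *)
have k1 : (1 <= k)%N.
  by case: k Lk => // Lk; rewrite mulr0 subr0 ltNge -expR0 ler_expR L0 in Lk.
have h4 : 4 * a * A <= B * expR L.
  rewrite -ler_pdivrMl// mulrC.
  rewrite -[leLHS]lnK ?posrE ?divr_gt0 ?mulr_gt0//.
  by rewrite ler_expR /L le_max lexx.
apply: le_ess_le => x; rewrite -(probability_Rintegral_cst nu (_ ^+ 2)).
have bh := bmf_iter_step k.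
apply: bmf_le_Rintegral => [| |y]; last 1 first.
- rewrite -ler_sqrt ?sqr_ge0// !sqrtr_sqr.
  rewrite [leRHS]ger0_norm ?mulr_ge0 ?expR_ge0 ?(ltW B0)//.
  rewrite (le_trans (ler_normB _ _))// (le_trans (lerD (decay x k1) (decay (mul y x) k1)))//.
  rewrite expRD [leRHS]mulrA; apply: le_trans (ler_wpM2r (expR_ge0 _) h4).
  by apply: eq_ler; ring.
- by apply/bmfX/bmfB; [exact: bmf_cst|exact: bmf_mulr].
- exact: bmf_cst.
Qed.

(** [f] is the sum of [h_i - P h_i] over [i < n] plus [h_n]. The [i]-th increment costs [k B e_i]
    times the integral of [w], these costs add up to at most [k C] times it, and [h_n] tends to 0 by
    mixing. *)
Lemma walk_bound (u w : T -> R) k : bmf u -> bmf w -> (forall x, 0 <= w x) ->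
  0 <= k -> (forall x x', `|u x - u x'| <= k * `|f x - f x'| * (w x + w x')) ->
  `|\int[mu]_x (u x * f x)| <= k * C * \int[mu]_x w x.
Proof.
move=> bu bw w0 k0 ulip.
pose e j := B * Num.min 1 (expR (L - b * j%:R)).
have e0 j : 0 < e j by rewrite mulr_gt0// lt_min ltr01 expR_gt0.
have W0 : 0 <= \int[mu]_x w x by exact: Rintegral_ge0.
have tele n : \int[mu]_x (u x * f x) = \int[mu]_x (u x * iter n step f x) +
    \sum_(i < n) \int[mu]_x (u x * (iter i step f x - step (iter i step f) x)).
  elim: n => [|n IH]; first by rewrite big_ord0 addr0.
  have bn := bmf_iter_step n.
  rewrite IH (_ : \int[mu]_x (u x * iter n step f x) =
      \int[mu]_x (u x * (iter n step f x - step (iter n step f) x)) +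
      \int[mu]_x (u x * step (iter n step f) x)); last first.
    rewrite -bmf_RintegralD.
    - by apply: eq_Rintegral => x _; rewrite -mulrDr subrK.
    - by apply: bmfM => //; apply: bmfB => //; exact: bmf_step.
    - by apply: bmfM => //; exact: bmf_step.
  by rewrite big_ord_recr/=; ring.
have sumle n : `|\sum_(i < n) \int[mu]_x (u x * (iter i step f x - step (iter i step f) x))|
    <= k * C * \int[mu]_x w x.
  apply: le_trans (ler_norm_sum _ _ _) _.
  apply: (@le_trans _ _ (\sum_(i < n) (k * B * \int[mu]_x w x * B) *
      Num.min 1 (expR (L - b * i%:R)))).
    apply: ler_sum => i _.
    apply: le_trans (Rintegral_step_increment bu bw bf (bmf_iter_step i) w0 k0 B0 (e0 i)
      ulip fB (ess_le_step_var_iter i)) _.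
    by apply: eq_ler; rewrite /e; ring.
  rewrite -mulr_sumr.
  have kW : 0 <= k * B * \int[mu]_x w x * B.
    by rewrite !mulr_ge0// ltW.
  apply: le_trans (ler_wpM2l kW (sum_min_expR_le n b0 L0)) _.
  apply: eq_ler; rewrite /C; field.
  by rewrite !gt_eqF// subr_gt0 expR_lt1 oppr_lt0.
have [_ [U uU]] := bu.
apply/ler_addgt0Pl => eps eps0.
(* The remainder is at most [eps] once [exp(b n) >= V], for which [b n >= V] suffices. *)
pose V := `|U| * (2 * A * a) / eps.
have V0 : 0 <= V.
  by rewrite divr_ge0 ?(ltW eps0)// mulr_ge0// !mulr_ge0// ltW.
(* The successor gives [n >= 1], as [decay] requires. *)
pose n := (Num.bound (V / b)).+1.
have hn : V / b < n%:R.
  apply: lt_trans (archi_boundP _) _; first by rewrite divr_ge0// ltW.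
  by rewrite ltr_nat.
rewrite (tele n); apply: le_trans (ler_normD _ _) _; apply: lerD (sumle n).
apply: (@le_trans _ _ (`|U| * (2 * A * (a * expR (- (b * n%:R)))))).
  apply: bmf_norm_Rintegral_le; first by apply: bmfM => //; exact: bmf_iter_step.
  move=> x; rewrite normrM; apply: ler_pM => //; last exact: decay.
  exact: le_trans (uU x) (ler_norm _).
rewrite expRN !mulrA ler_pdivrMr ?expR_gt0//.
have Vn : V <= expR (b * n%:R).
  apply: le_trans (expR_ge1Dx _); rewrite ltr_pdivrMr// mulrC in hn.
  by rewrite (le_trans (ltW hn))// lerDr.
apply: le_trans (ler_wpM2l (ltW eps0) Vn).
by apply: eq_ler; rewrite /V; field; rewrite gt_eqF.
Qed.

Lemma walk_variance : \int[mu]_x (f x ^+ 2) <= C / 2.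
Proof.
have := @walk_bound f (fun=> 1) 2^-1 bf (bmf_cst _) (fun=> ler01).
rewrite probability_Rintegral_cst mulr1 invr_ge0 ler0n => /(_ isT).
rewrite (mulrC _ C) => H; apply: le_trans (H _); first exact: ler_norm.
by move=> x x'; apply: eq_ler; field.
Qed.

(** For the Laplace transform [m], convexity of exp gives [m s >= m r - (r - s) E[f exp(r f)]], and
    [walk_bound] with constant [r / 2] bounds the expectation by [(r C / 2) m r]. This is the
    tangent inequality with [c = C / 2]. *)
Lemma walk_mgf t : 0 <= t -> \int[mu]_x expR (t * f x) <= expR (C / 4 * t ^+ 2).
Proof.
move=> t0.
have bex s : bmf (fun x => expR (s * f x)).
  by apply/bmf_expR/bmfM => //; exact: bmf_cst.
have -> : C / 4 * t ^+ 2 = C / 2 * t ^+ 2 / 2 by field.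
apply: (@le_exp_of_tangent _ (fun s => \int[mu]_x expR (s * f x))) => //.
- by rewrite divr_ge0// ltW.
- under eq_Rintegral do rewrite mul0r expR0.
  exact: probability_Rintegral_cst.
- move=> s; have [_ [M fM]] := bf.
  apply: (@lt_le_trans _ _ (expR (- (`|s| * M)))); first exact: expR_gt0.
  rewrite -(probability_Rintegral_cst mu (expR _)).
  apply: bmf_le_Rintegral => //; first exact: bmf_cst.
  move=> x; rewrite ler_expR.
  have : `|s * f x| <= `|s| * M by rewrite normrM ler_wpM2l.
  by rewrite ler_norml => /andP[].
- move=> s r s0 sr.
  have r0 := le_trans s0 sr.
  have H := @walk_bound (fun x => expR (r * f x)) (fun x => expR (r * f x)) (r / 2)
    (bex r) (bex r) (fun x => expR_ge0 _).
  have {}H : \int[mu]_x (expR (r * f x) * f x) <= r / 2 * C * \int[mu]_x expR (r * f x).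
    apply: le_trans (ler_norm _) (H _ _); first by rewrite divr_ge0.
    move=> x x'; apply: le_trans (expR_lipschitz _ _) _.
    rewrite -mulrBr normrM ger0_norm//; apply: eq_ler; ring.
  have bfe : bmf (fun x => expR (r * f x) * f x) by exact: bmfM.
  apply: (@le_trans _ _ (\int[mu]_x expR (r * f x) -
      (r - s) * \int[mu]_x (expR (r * f x) * f x))).
    have rs : 0 <= r - s by rewrite subr_ge0.
    have := ler_wpM2l rs H; lra.
  rewrite -bmf_RintegralZ// -bmf_RintegralB//; last first.
    by apply: bmfM => //; exact: bmf_cst.
  apply: bmf_le_Rintegral => //.
    by apply: bmfB => //; apply: bmfM => //; exact: bmf_cst.
  move=> x; have := ler_wpM2l (expR_ge0 (r * f x)) (expR_ge1Dx ((s - r) * f x)).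
  rewrite -expRD (_ : r * f x + _ = s * f x); last by ring.
  by apply: le_trans; apply: eq_ler; ring.
Qed.

Lemma walk_upper_tail (t : R) : 0 <= t ->
  (mu [set x | (t <= f x)%R] <= (expR (- (t ^+ 2) / C))%:E)%E.
Proof.
(* The minimizer of [- s t + C s^2 / 4]; the minimum is [- t^2 / C]. *)
move=> t0; pose s := 2 * t / C.
have s0 : 0 <= s by rewrite divr_ge0 ?(ltW C0) ?mulr_ge0.
set E := [set x | _].
have mE : measurable E.
  rewrite (_ : E = [set: T] `&` f @^-1` `[t, +oo[); last first.
    by apply/seteqP; split => x; rewrite /E/= in_itv/= andbT => -[]//.
  by apply: (proj1 bf) => //; exact: measurable_itv.
have bE : bmf (\1_E : T -> R).
  split; first exact: measurable_indic.
  by exists 1 => x; rewrite indicE; case: (_ \in _); rewrite ?normr1 ?normr0.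
rewrite -(setIT E) -integral_indic// EFin_bmf_Rintegral// lee_fin.
have := walk_mgf s0; rewrite -(ler_pM2l (expR_gt0 (- (s * t)))) -expRD.
rewrite (_ : - (s * t) + _ = - (t ^+ 2) / C); last by rewrite /s; field; rewrite gt_eqF.
have bex : bmf (fun x => expR (s * f x)).
  by apply/bmf_expR/bmfM => //; exact: bmf_cst.
rewrite -bmf_RintegralZ//; apply: le_trans.
apply: bmf_le_Rintegral => //; first by apply: bmfM => //; exact: bmf_cst.
move=> x; rewrite indicE -expRD; have [|_] := boolP (x \in E); last exact: expR_ge0.
rewrite inE => tf; rewrite -[leLHS]expR0 ler_expR addrC subr_ge0.
exact: ler_wpM2l.
Qed.

End concentration.

Lemma step_opp (h : T -> R) : bmf h -> step (fun x => - h x) = fun x => - step h x.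
Proof.
move=> bh; apply/funext => x; rewrite /step -[RHS]mulN1r -bmf_RintegralZ; last exact: bmf_mulr.
by apply: eq_Rintegral => y _; rewrite mulN1r.
Qed.

Lemma walk_tail (f : T -> R) (a b A B t : R) : bmf f ->
  0 < a -> 0 < b -> 0 < A -> 0 < B -> ess_le (step_var f) (B ^+ 2) ->
  (forall k x, (1 <= k)%N ->
    `|iter k step f x| <= 2 * A * (a * expR (- (b * k%:R)))) ->
  0 <= t ->
  (mu [set x | (t <= `|f x|)%R] <= (2 * expR (- (t ^+ 2) / (B ^+ 2 / b *
    (Num.max (ln (4 * a * A / B)) 0 + b / (1 - expR (- b))))))%:E)%E.
Proof.
move=> bf a0 b0 A0 B0 fB decay t0.
have bN : bmf (fun x => - f x).
  by under [X in bmf X]eq_fun do rewrite -mulN1r; apply: bmfM => //; exact: bmf_cst.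
have NB : ess_le (step_var (fun x => - f x)) (B ^+ 2).
  rewrite (_ : step_var _ = step_var f)//; apply/funext => x.
  by apply: eq_Rintegral => y _; rewrite -opprD sqrrN.
have Ndecay k x : (1 <= k)%N ->
    `|iter k step (fun x => - f x) x| <= 2 * A * (a * expR (- (b * k%:R))).
  rewrite (_ : iter k step _ = fun x => - iter k step f x).
    by rewrite normrN; exact: decay.
  elim: k => // k IH; rewrite !iterS IH step_opp//; exact: bmf_iter_step.
have up := walk_upper_tail bf a0 b0 A0 B0 fB decay t0.
have lo := walk_upper_tail bN a0 b0 A0 B0 NB Ndecay t0.
have mge (g : T -> R) : bmf g -> measurable [set x | t <= g x].
  move=> [mg _]; rewrite (_ : [set x | t <= g x] = [set: T] `&` g @^-1` `[t, +oo[); last first.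
    by apply/seteqP; split => x; rewrite /= in_itv/= andbT => -[]//.
  by apply: mg => //; exact: measurable_itv.
rewrite (_ : [set x | _] = [set x | t <= f x] `|` [set x | t <= - f x]); last first.
  apply/seteqP; split=> x /=; first by rewrite ler_normr => /orP.
  by rewrite ler_normr => /orP.
apply: le_trans (measureU2 _ (mge _ bf) (mge _ bN)) _.
by rewrite mulr2n mulrDl mul1r EFinD leeD.
Qed.

End random_walk.

(** * Laws of random variables and changes on null sets *)

Section law.
Context {R : realType} {d d'} {Omega : measurableType d} {T : measurableType d'}.
Implicit Types (P : probability Omega R) (X : Omega -> T).

Definition law P X (mX : measurable_fun [set: Omega] X) : probability T R :=
  distribution P (mfun_Sub (mem_set mX : X \in mfun)).

Lemma Rintegral_law P X (mX : measurable_fun [set: Omega] X) (h : T -> R) :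
  bmf h -> \int[law P mX]_y h y = \int[P]_w h (X w).
Proof.
move=> bh; congr fine; rewrite integral_distribution//.
  by apply/measurable_EFinP; case: bh.
by apply: (bmf_integrable P); exact: bmf_comp bh.
Qed.

Lemma eq_law_Rintegral (m1 m2 : probability T R) (h : T -> R) :
  (forall E, measurable E -> m1 E = m2 E) -> \int[m1]_y h y = \int[m2]_y h y.
Proof.
by move=> m12; congr fine; apply: eq_measure_integral => E mE _; exact: m12.
Qed.

Lemma Rintegral_indic (m : probability T R) E : measurable E ->
  \int[m]_y (\1_E y) = fine (m E).
Proof. by move=> mE; rewrite /Rintegral integral_indic// setIT. Qed.

Lemma bmf_indic (E : set T) : measurable E -> bmf (\1_E : T -> R).
Proof.
move=> mE; split; first exact: measurable_indic.
by exists 1 => x; rewrite indicE; case: (_ \in _); rewrite ?normr1 ?normr0.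
Qed.

Lemma Rintegral_eq_off_null (m : probability T R) E (g h : T -> R) :
  measurable E -> m E = 0%E -> bmf g -> bmf h -> (forall x, ~ E x -> g x = h x) ->
  \int[m]_y g y = \int[m]_y h y.
Proof.
move=> mE E0 bg bh gh; apply/eqP; rewrite -subr_eq0 -bmf_RintegralB// -normr_eq0.
rewrite eq_le normr_ge0 andbT.
have bgh := bmfB bg bh; have [_ [M ghM]] := bgh.
apply: le_trans (bmf_le_norm_Rintegral _ bgh) _.
have -> : 0 = M * \int[m]_y (\1_E y) by rewrite Rintegral_indic// E0 mulr0.
rewrite -bmf_RintegralZ; last exact: bmf_indic.
apply: bmf_le_Rintegral; first exact: bmf_norm.
  by apply: bmfM; [exact: bmf_cst|exact: bmf_indic].
move=> x; rewrite indicE; have [xE|] := boolP (x \in E); first by rewrite mulr1.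
by rewrite notin_setE => /gh->; rewrite subrr normr0 mulr0.
Qed.

End law.

(** * Expectations of bounded functions and total variation *)

Section total_variation.
Context {R : realType} {d} {T : measurableType d}.
Variables (m1 m2 : probability T R) (delta : R).
Hypothesis tv : forall E, measurable E -> `|fine (m1 E) - fine (m2 E)| <= delta.

Let count_le n (y : R) : \sum_(j < n) (j.+1%:R <= y)%R%:R <= Num.max y 0 :> R.
Proof.
elim: n y => [|n IH] y; first by rewrite big_ord0 le_max lexx orbT.
rewrite big_ord_recl /=.
under eq_bigr => j _ do rewrite /bump/= add1n -natr1 -lerBrDr.
have := IH (y - 1); rewrite le_max.
by have [y1|y1] := leP 1 y => /=; rewrite !le_max => /orP[]; lra.
Qed.

Let le_count n (y : R) : y <= n%:R ->
  y <= \sum_(j < n) (j.+1%:R <= y)%R%:R + 1 :> R.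
Proof.
elim: n y => [|n IH] y yn.
  by rewrite big_ord0 add0r (le_trans yn).
rewrite big_ord_recl /=.
under eq_bigr => j _ do rewrite /bump/= add1n -natr1 -lerBrDr.
have [y1|y1] := leP 1 y => /=.
  have := IH (y - 1); rewrite lerBlDr natr1 => /(_ yn); lra.
have : 0 <= \sum_(i < n) (i.+1%:R <= y - 1)%R%:R :> R by apply: sumr_ge0.
by lra.
Qed.

(* Layer cake: h is within 1/n of the average of the indicators of the level
   sets {h >= j/n}. *)
Let unit_bound (h : T -> R) : bmf h -> (forall x, 0 <= h x <= 1) ->
  \int[m1]_x h x - \int[m2]_x h x <= delta.
Proof.
move=> bh h01; apply/ler_addgt0Pr => e e0.
pose n := (Num.bound e^-1).+1.
have n0 : 0 < n%:R :> R by rewrite ltr0n.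
have ne : n%:R^-1 <= e.
  rewrite -[leRHS]invrK lef_pV2 ?posrE ?invr_gt0//.
  apply: ltW; apply: lt_trans (archi_boundP _) _; first by rewrite invr_ge0 ltW.
  by rewrite ltr_nat.
pose E j := [set x | j.+1%:R <= n%:R * h x].
have mE j : measurable (E j).
  have [mh _] := bh.
  rewrite (_ : E j = [set: T] `&` h @^-1` `[j.+1%:R / n%:R, +oo[).
    by apply: mh => //; exact: measurable_itv.
  apply/seteqP; split => x /=; rewrite /E/= in_itv/= andbT ler_pdivrMr// mulrC => //.
  by case.
pose g x := n%:R^-1 * \sum_(j < n) (\1_(E j) x : R).
have b1 j : bmf (\1_(E j) : T -> R) by exact: bmf_indic.
have bS m : bmf (fun x => \sum_(j < m) (\1_(E j) x : R)).
  elim: m => [|m IH].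
    by under [X in bmf X]eq_fun do rewrite big_ord0; exact: bmf_cst.
  by under [X in bmf X]eq_fun do rewrite big_ord_recr; exact: bmfD.
have Sint (m : probability T R) k :
    \int[m]_x (\sum_(j < k) (\1_(E j) x : R)) = \sum_(j < k) fine (m (E j)).
  elim: k => [|k IH].
    under eq_Rintegral do rewrite big_ord0.
    by rewrite big_ord0 probability_Rintegral_cst.
  rewrite big_ord_recr/= -IH -Rintegral_indic// -(bmf_RintegralD m (bS k) (b1 k)).
  by apply: eq_Rintegral => x _; rewrite big_ord_recr.
have bg : bmf g by apply: bmfM => //; exact: bmf_cst.
have gE x : g x = n%:R^-1 * \sum_(j < n) (j.+1%:R <= n%:R * h x)%R%:R.
  congr (_ * _); apply: eq_bigr => j _; rewrite indicE.
  by congr (_%:R); congr nat_of_bool; apply/idP/idP; rewrite inE.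
have g_le x : g x <= h x.
  have /andP[h0 _] := h01 x.
  rewrite gE mulrC ler_pdivrMr// mulrC; apply: le_trans (count_le _ _) _.
  by rewrite ge_max lexx mulr_ge0.
have h_le x : h x <= g x + n%:R^-1.
  have /andP[_ h1] := h01 x.
  rewrite gE -[X in _ + X]mulr1 -mulrDr mulrC ler_pdivlMr// mulrC.
  by apply: le_count; rewrite -[leRHS]mulr1 ler_wpM2l.
have I1 : \int[m1]_x h x <= \int[m1]_x g x + n%:R^-1.
  rewrite -[X in _ + X](probability_Rintegral_cst m1) -bmf_RintegralD//; last exact: bmf_cst.
  by apply: bmf_le_Rintegral => //; apply: bmfD => //; exact: bmf_cst.
have I2 : \int[m2]_x g x <= \int[m2]_x h x by exact: bmf_le_Rintegral.
have I3 : \int[m1]_x g x - \int[m2]_x g x <= delta.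
  rewrite /g !bmf_RintegralZ// !Sint -mulrBr -sumrB mulrC ler_pdivrMr//.
  apply: (@le_trans _ _ (\sum_(j < n) delta)).
    by apply: ler_sum => j _; apply: le_trans (ler_norm _) (tv (mE j)).
  by rewrite sumr_const card_ord mulr_natr.
lra.
Qed.

(** The map [(g + A) / (2 A)] brings the range into [[0, 1]] at the cost of the factor [2 A]; the
    shift cancels because both measures have mass 1. *)
Lemma tv_Rintegral (A : R) (h : T -> R) : 0 < A -> bmf h -> (forall x, `|h x| <= A) ->
  `|\int[m1]_x h x - \int[m2]_x h x| <= 2 * A * delta.
Proof.
move=> A0 bh hA.
have A2 : 0 < 2 * A by rewrite mulr_gt0.
suff key (g : T -> R) : bmf g -> (forall x, `|g x| <= A) ->
    \int[m1]_x g x - \int[m2]_x g x <= 2 * A * delta.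
  rewrite ler_norml key// andbT lerNl opprB.
  have bN : bmf (fun x => -1 * h x) by apply: bmfM => //; exact: bmf_cst.
  have := key _ bN; rewrite !bmf_RintegralZ// !mulN1r opprK addrC; apply.
  by move=> x; rewrite mulN1r normrN.
move=> bg gA; pose k x := (2 * A)^-1 * (g x + A).
have bk : bmf k by apply: bmfM; [exact: bmf_cst|apply: bmfD => //; exact: bmf_cst].
have := unit_bound bk; rewrite /k !bmf_RintegralZ//; last 2 first.
- by apply: bmfD => //; exact: bmf_cst.
- by apply: bmfD => //; exact: bmf_cst.
rewrite !bmf_RintegralD//; try exact: bmf_cst.
rewrite !probability_Rintegral_cst -mulrBr opprD addrACA subrr addr0.
rewrite ler_pdivrMl//; apply => x.
have := gA x; rewrite ler_norml => /andP[g1 g2].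
rewrite mulr_ge0 ?invr_ge0 ?(ltW A2)//=; last by lra.
by rewrite ler_pdivrMl//; lra.
Qed.

End total_variation.

(** * Independence of a partial product and the next factor *)

Section product_of_independent.
Context {R : realType} {d d'} {Omega : measurableType d} {T : measurableType d'}.
Variables (P : probability Omega R) (mul : T -> T -> T) (e : T).
Variables (Y Z : nat -> Omega -> T).
Hypothesis mmul : measurable_fun [set: T * T] (fun p => mul p.1 p.2).
Hypothesis mY : forall i, measurable_fun [set: Omega] (Y i).
Hypothesis Z0 : Z 0 = fun _ => e.
Hypothesis ZS : forall k, Z k.+1 = fun w => mul (Z k w) (Y k w).
Hypothesis Yindep : forall (n : nat) (E : nat -> set T), (forall i, measurable (E i)) ->
  fine (P (\bigcap_(i in `I_n) (Y i @^-1` E i))) = \prod_(i < n) fine (P (Y i @^-1` E i)).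

Lemma measurable_walk k : measurable_fun [set: Omega] (Z k).
Proof.
elim: k => [|k IH]; first by rewrite Z0; exact: measurable_cst.
by rewrite ZS; apply: (measurableT_comp mmul (measurable_fun_pair IH (mY k))).
Qed.

(** Independence from the walk is proved for whole blocks of later factors, since the induction on
    [k] moves the first factor of the block into the walk. *)
Let H k n (E : nat -> set T) := \bigcap_(i in [set i | (k <= i < n)%N]) (Y i @^-1` E i).

Let mpre (X : Omega -> T) E : measurable_fun [set: Omega] X -> measurable E ->
  measurable (X @^-1` E).
Proof. by move=> mX mE; rewrite -[_ @^-1` _]setTI; exact: mX. Qed.

Let mH k n E : (forall i, measurable (E i)) -> measurable (H k n E).
Proof.
by move=> mE; apply: bigcap_measurableType => i _; exact: mpre.
Qed.

Let Hsplit k n E : (k < n)%N -> H k n E = Y k @^-1` E k `&` H k.+1 n E.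
Proof.
move=> kn; apply/seteqP; split=> w.
  move=> Hw; split; first by apply: Hw; rewrite /= leqnn.
  by move=> i /= /andP[ki ni]; apply: Hw; rewrite /= ni (ltnW ki).
move=> [Yw Hw] i /= /andP[]; rewrite leq_eqVlt => /predU1P[<-//|ki ni].
by apply: Hw; rewrite /= ki.
Qed.

Let PH k n E : (k <= n)%N -> (forall i, measurable (E i)) ->
  P (H k n E) = (\prod_(k <= i < n) fine (P (Y i @^-1` E i)))%:E.
Proof.
move=> kn mE; rewrite -[LHS]fineK ?fin_num_measure//; last exact: mH.
congr EFin.
(* Padding with the full set below [k] yields an initial segment, the form in which independence is
   assumed. *)
pose E' i := if (k <= i)%N then E i else setT.
have mE' i : measurable (E' i) by rewrite /E'; case: ifP.
have -> : H k n E = \bigcap_(i in `I_n) (Y i @^-1` E' i).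
  apply/seteqP; split=> w Hw i /=.
    by move=> ni; rewrite /E' /preimage/=; case: ifPn => // ki; apply: Hw; rewrite /= ki.
  by move=> /andP[ki ni]; have := Hw i ni; rewrite /E' ki.
rewrite Yindep// -(big_mkord xpredT (fun i => fine (P (Y i @^-1` E' i)))).
rewrite (big_cat_nat _ kn)//= big_nat_cond big1 ?mul1r; last first.
  move=> i /andP[/andP[_ ik] _]; rewrite /E' leqNgt ik/= preimage_setT.
  by have -> := probability_setT P.
by apply: eq_big_nat => i /andP[ki _]; rewrite /E' ki.
Qed.

Let PHsplit k n E : (k < n)%N -> (forall i, measurable (E i)) ->
  P (H k n E) = (P (Y k @^-1` E k) * P (H k.+1 n E))%E.
Proof.
move=> kn mE; rewrite !PH// ?(ltnW kn)// big_ltn// EFinM fineK//.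
by apply: fin_num_measure; exact: mpre.
Qed.

(** For [k + 1], the law of [(Z k, Y k)] restricted to the event [H k.+1 n E] is compared with the
    full law scaled by the probability of that event. They agree on rectangles by induction, hence
    on the preimage of [F] under [mul]. *)
Let walk_indep k n E F : measurable F -> (forall i, measurable (E i)) ->
  P (Z k @^-1` F `&` H k n E) = (P (Z k @^-1` F) * P (H k n E))%E.
Proof.
elim: k n E F => [|k IH] n E F mF mE.
  rewrite Z0; have [Fe|nFe] := pselect (F e).
    rewrite (_ : _ @^-1` F = setT); last by apply/seteqP; split.
    by rewrite setTI; have -> := probability_setT P; rewrite mul1e.
  rewrite (_ : _ @^-1` F = set0); last by apply/seteqP; split.
  by rewrite set0I measure0 mul0e.
have [nk|kn] := leqP n k.
  rewrite (_ : H k.+1 n E = setT); last first.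
    apply/seteqP; split=> // w _ i /= /andP[ki ni].
    by move: (leq_ltn_trans (leq_trans nk (ltnW ki)) ni); rewrite ltnn.
  by rewrite setIT; have -> := probability_setT P; rewrite mule1.
pose ZY w := (Z k w, Y k w).
have mZY : measurable_fun setT ZY by exact: measurable_fun_pair (measurable_walk k) (mY k).
have mHk : measurable (H k.+1 n E) by exact: mH.
pose c : {nonneg R} := NngNum (fine_ge0 (measure_ge0 P (H k.+1 n E))).
have cE : (c%:num)%:E = P (H k.+1 n E) by rewrite /= fineK// fin_num_measure.
pose m1 : {measure set (T * T)%type -> \bar R} :=
  pushforward (mrestr P mHk) ZY.
pose m2 : {measure set (T * T)%type -> \bar R} :=
  mscale c (pushforward P ZY).
have m1E S : m1 mZY S = P (ZY @^-1` S `&` H k.+1 n E) by [].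
have m2E S : m2 mZY S = (P (H k.+1 n E) * P (ZY @^-1` S))%E by rewrite -cE.
suff m12 S : measurable S -> m1 mZY S = m2 mZY S.
  have mS : measurable ((fun p : T * T => mul p.1 p.2) @^-1` F).
    by rewrite -[_ @^-1` _]setTI; exact: mmul.
  by have := m12 _ mS; rewrite m1E m2E ZS muleC.
apply: (@measure_unique _ R _ _ (fun=> [set: T * T])
  (@measurable_prod_measurableType _ _ T T)).
- move=> _ _ [A1 mA1 [B1 mB1 <-]] [A2 mA2 [B2 mB2 <-]].
  rewrite -setXI; exists (A1 `&` A2); first exact: measurableI.
  by exists (B1 `&` B2) => //; exact: measurableI.
- by move=> _; exists setT => //; exists setT => //; rewrite setXTT.
- by rewrite bigcup_const//; exists 0%N.
- move=> _ [A1 mA1 [B1 mB1 <-]]; rewrite m1E m2E.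
  (* Putting [B1] at index [k] absorbs the condition on [Y k] into a block starting at [k], to which
     the induction hypothesis applies. *)
  pose E' i := if i == k then B1 else E i.
  have mE' i : measurable (E' i) by rewrite /E'; case: ifP.
  have H' : H k.+1 n E' = H k.+1 n E.
    apply/seteqP; split=> w Hw i /= /andP[ki ni]; have := Hw i; rewrite /= ki ni => /(_ isT);
    by rewrite /E' gtn_eqF.
  have E'k : E' k = B1 by rewrite /E' eqxx.
  have -> : ZY @^-1` (A1 `*` B1) `&` H k.+1 n E = Z k @^-1` A1 `&` H k n E'.
    by rewrite (@Hsplit k n E' kn) H' E'k setIA.
  have -> : ZY @^-1` (A1 `*` B1) = Z k @^-1` A1 `&` H k k.+1 E'.
    rewrite (@Hsplit k k.+1 E' (ltnSn k)) E'k (_ : H k.+1 k.+1 E' = setT) ?setIT//.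
    by apply/seteqP; split=> // w _ i /= /andP[ki]; rewrite ltnNge ki.
  rewrite !IH// (@PHsplit k n E' kn mE') (@PHsplit k k.+1 E' (ltnSn k) mE') H' E'k.
  rewrite (_ : H k.+1 k.+1 E' = setT); last first.
    by apply/seteqP; split=> // w _ i /= /andP[ki]; rewrite ltnNge ki.
  by have -> := probability_setT P; rewrite mule1 muleA muleC.
- by move=> _; rewrite m1E preimage_setT setTI ltey_eq fin_num_measure.
Qed.

(** By independence the joint law of [Z k] and [Y k] is a product. This turns iterates of [step]
    into expectations over the walk. *)
Lemma Rintegral_walk_step k (h : T * T -> R) : bmf h ->
  \int[P]_w h (Z k w, Y k w) =
  \int[law P (mY k)]_y \int[P]_w h (Z k w, y).
Proof.
move=> bh; pose mZ := measurable_walk k.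
have mZY : measurable_fun setT (fun w => (Z k w, Y k w)).
  exact: measurable_fun_pair mZ (mY k).
rewrite -(Rintegral_law P mZY bh).
under [RHS]eq_Rintegral do rewrite -(Rintegral_law P mZ (bmf_section2 _ bh)).
rewrite bmf_fubini2//; apply: eq_law_Rintegral => S mS; apply/esym.
apply: product_measure_unique mS => A B mA mB.
suff : P (Z k @^-1` A `&` Y k @^-1` B) = (P (Z k @^-1` A) * P (Y k @^-1` B))%E by [].
pose E (i : nat) := B.
have E1 : Y k @^-1` B = H k k.+1 E.
  rewrite (@Hsplit k k.+1 E (ltnSn k)) (_ : H k.+1 k.+1 E = setT) ?setIT//.
  by apply/seteqP; split=> // w _ i /= /andP[ki]; rewrite ltnNge ki.
by rewrite E1 -walk_indep// -E1.
Qed.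

End product_of_independent.

(** * Scales of neighborhoods and the quotients they define *)

Section compact_group.
Context {G : TopGroup.type}.
Hypothesis Gmul_cont : continuous (fun p : G * G => (p.1 * p.2)%g).
Hypothesis Ginv_cont : continuous (fun x : G => (x^-1)%g).
Hypothesis Gcompact : compact [set: G].

Let cvg_mul (T : Type) (F : set_system T) (g h : T -> G) (x y : G) : Filter F ->
  g @ F --> x -> h @ F --> y -> (g z * h z)%g @[z --> F] --> (x * y)%g.
Proof.
move=> FF gx hy; apply: (cvg_comp (fun z => (g z, h z)) (fun p : G * G => (p.1 * p.2)%g)).
  exact: cvg_pair gx hy.
exact: (@Gmul_cont (x, y)).
Qed.

Lemma continuous_mulgl (x : G) : continuous (fun y => x * y)%g.
Proof. by move=> y; apply: cvg_mul => //; exact: cvg_cst. Qed.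

Lemma continuous_mulgr (x : G) : continuous (fun y => y * x)%g.
Proof. by move=> y; apply: cvg_mul => //; exact: cvg_cst. Qed.

(* The intersection of the [W n] is a closed normal subgroup; the sets
   [scale_open W] below are the inverse images of the open subsets of the
   quotient, which is second countable. *)
Record scale (W : nat -> set G) : Prop := Scale {
  scale_nbhs : forall n, nbhs (1%g : G) (W n) ;
  scaleM : forall n x y, W n.+1 x -> W n.+1 y -> W n (x * y)%g ;
  scaleV : forall n x, W n x -> W n (x^-1)%g ;
  scaleJ : forall n x y, W n x -> W n (y * x * y^-1)%g }.

Let conj_cont (x : G) :
  ((fun p : G * G => (p.1 * p.2 * p.1^-1)%g) @ (x, 1%g : G)) --> (1%g : G).
Proof.
suff : (fun p : G * G => (p.1 * p.2 * p.1^-1)%g) @ (x, 1%g : G) --> (x * 1 * x^-1)%g.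
  by rewrite mulg1 mulgV.
have nF : Filter (nbhs (x, 1%g : G)) by exact: nbhs_filter.
apply: (@cvg_mul _ (nbhs (x, 1%g : G)) (fun p => (p.1 * p.2)%g) (fun p => (p.1^-1)%g)).
  exact: (@Gmul_cont (x, 1%g)).
apply: (cvg_comp fst (fun x : G => x^-1)%g); first exact: cvg_fst.
exact: Ginv_cont.
Qed.

(** Continuity at the unit gives [D] with [D D] inside [U]. By compactness, the points all of whose
    conjugates lie in [D] still form a neighborhood [E], which is then intersected with its
    inverse. *)
Lemma scale_step (U : set G) : nbhs (1%g : G) U -> exists V : set G,
  [/\ nbhs (1%g : G) V, forall x y, V x -> V y -> U (x * y)%g,
      forall x, V x -> V (x^-1)%g & forall x y, V x -> V (y * x * y^-1)%g].
Proof.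
move=> U1.
have [[A B]/= [nA nB] AB] : nbhs (1%g : G, 1%g : G) ((fun p : G * G => (p.1 * p.2)%g) @^-1` U).
  by apply: (@Gmul_cont (1%g, 1%g)); rewrite /= mulg1.
pose D := A `&` B.
have nD : nbhs (1%g : G) D by exact: filterI.
have DU x y : D x -> D y -> U (x * y)%g by move=> [Ax _] [_ By]; exact: (AB (x, y)).
pose E := [set w | forall x, D (x * w * x^-1)%g].
have nE : nbhs (1%g : G) E.
  have /(compact_near_coveringP _).1 := Gcompact.
  move=> /(_ _ (nbhs (1%g : G)) (fun w x => D (x * w * x^-1)%g)) H.
  have {}H := H (nbhs_filter _) (fun x _ => @conj_cont x D nD).
  by apply: filterS H => w Hw x; exact: Hw.
exists [set w | E w /\ E (w^-1)%g]; split.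
- apply: filterI => //; have := @Ginv_cont 1%g; rewrite /continuous_at invg1; exact.
- move=> x y [+ _] [+ _] => /(_ 1%g) + /(_ 1%g).
  by rewrite invg1 !mul1g !mulg1; exact: DU.
- by move=> x [Ex Exi]; split => //; rewrite invgK.
- move=> x y [Ex Exi]; split => z.
    by have := Ex (z * y)%g; rewrite invgM !mulgA.
  by have := Exi (z * y)%g; rewrite !invgM invgK !mulgA.
Qed.

Lemma exists_scale (U : set G) : nbhs (1%g : G) U ->
  exists2 W, scale W & W 0%N `<=` U.
Proof.
move=> U1.
have /choice[F HF] (A : set G) : exists V : set G, nbhs (1%g : G) A ->
    [/\ nbhs (1%g : G) V, forall x y, V x -> V y -> A (x * y)%g,
      forall x, V x -> V (x^-1)%g & forall x y, V x -> V (y * x * y^-1)%g].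
  by have [/scale_step[V HV]|] := pselect (nbhs (1%g : G) A); [exists V|exists A].
have nF n : nbhs (1%g : G) (iter n F U).
  by elim: n => //= n IH; have [] := HF _ IH.
(* The scale starts at the first iterate: [U] itself need be neither symmetric nor conjugation
   invariant. *)
exists (fun n => iter n.+1 F U).
  split => n.
  - exact: nF.
  - by have [] := HF _ (nF n.+1).
  - by have [] := HF _ (nF n).
  - by have [] := HF _ (nF n).
move=> x Fx; have [n1 H _ _] := HF _ (nF 0%N).
by rewrite -[x]mulg1; apply: H => //; exact: nbhs_singleton.
Qed.

Lemma scale1 W n : scale W -> W n 1%g.
Proof. by move=> sW; exact: (nbhs_singleton (scale_nbhs sW n)). Qed.

Lemma scale_le W m n : scale W -> (m <= n)%N -> W n `<=` W m.
Proof.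
move=> sW; elim: n => [|n IH]; first by rewrite leqn0 => /eqP->.
rewrite leq_eqVlt ltnS => /predU1P[->//|/IH nk] z Wz; apply: nk.
by rewrite -[z]mulg1; apply: (scaleM sW) => //; exact: scale1.
Qed.

Definition scale_open (W : nat -> set G) : set (set G) :=
  [set O | forall x, O x -> exists n, forall w, W n w -> O (x * w)%g].

(** Only finitely many scales enter at each level, so the levels remain neighborhoods; from level
    [i] on, the [i]-th scale is refined. Countably many sets can thus be treated in one quotient. *)
Lemma scale_merge (W : nat -> nat -> set G) : (forall i, scale (W i)) ->
  exists2 W', scale W' & forall i, scale_open (W i) `<=` scale_open W'.
Proof.
move=> sW; exists (fun n => [set w | forall i, (i <= n)%N -> W i n w]).
  split => n.
  - suff : forall m, nbhs (1%g : G) [set w | forall i, (i <= m)%N -> W i n w] by exact.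
    elim=> [|m IH].
      apply: filterS (scale_nbhs (sW 0%N) n) => w Ww i.
      by rewrite leqn0 => /eqP->.
    apply: filterS (filterI IH (scale_nbhs (sW m.+1) n)) => w [Hw Ww] i.
    by rewrite leq_eqVlt ltnS => /predU1P[->//|]; exact: Hw.
  - move=> x y Wx Wy i ni.
    by apply: (scaleM (sW i)); [apply: Wx|apply: Wy]; rewrite (leq_trans ni).
  - by move=> x Wx i ni; apply/(scaleV (sW i))/Wx.
  - by move=> x y Wx i ni; apply/(scaleJ (sW i))/Wx.
move=> i O OW x /OW[n Wn].
exists (maxn n i) => w Ww; apply: Wn.
have : W i (maxn n i) w by apply: Ww; rewrite leq_maxr.
by apply: (scale_le (sW i)); exact: leq_maxl.
Qed.

Section scale_topology.
Context (W : nat -> set G).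
Hypothesis sW : scale W.

Lemma scaleVM n x y : W n.+1 x -> W n.+1 y -> W n (x^-1 * y)%g.
Proof. by move=> Wx Wy; apply: (scaleM sW) => //; exact: scaleV. Qed.

Lemma scale_open_open O : scale_open W O -> open O.
Proof.
move=> WO; rewrite openE => x /WO[n Wn].
have : nbhs x ((fun y => x^-1 * y)%g @^-1` W n).
  by apply: (@continuous_mulgl (x^-1)%g x); rewrite mulVg; exact: (scale_nbhs sW).
by apply: filterS => y /Wn; rewrite mulgA mulgV mul1g.
Qed.

Lemma scale_open_bigcup (F : nat -> set G) : (forall i, scale_open W (F i)) ->
  scale_open W (\bigcup_i F i).
Proof.
by move=> WF x [i _ /WF[n Wn]]; exists n => w /Wn; exists i.
Qed.

Lemma scale_openU A B : scale_open W A -> scale_open W B ->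
  scale_open W (A `|` B).
Proof.
by move=> WA WB x [/WA[n Wn]|/WB[n Wn]]; exists n => w /Wn; [left|right].
Qed.

Lemma scale_open_mulr x O : scale_open W O ->
  scale_open W ((fun y => y * x)%g @^-1` O).
Proof.
move=> WO y /WO[n Wn]; exists n => w Ww; have := Wn _ (scaleJ sW (x^-1)%g Ww).
by rewrite /preimage/= invgK !mulgA mulgK.
Qed.

Lemma scale_open_inv O : scale_open W O ->
  scale_open W ((fun y => y^-1)%g @^-1` O).
Proof.
move=> WO y /WO[n Wn]; exists n => w Ww; have := Wn _ (scaleJ sW y (scaleV sW Ww)).
by rewrite /preimage/= invgM !mulgA mulVg mul1g.
Qed.

(** The interior of the translate [x W_n] in the topology of the scale. *)
Definition sball n (x : G) : set G :=
  [set y | exists m, forall w, W m w -> W n (x^-1 * y * w)%g].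

Lemma scale_open_sball n x : scale_open W (sball n x).
Proof.
move=> y [m Wm]; exists m.+1 => w Ww; exists m.+1 => v Wv.
by rewrite /= mulgA -[X in W n X]mulgA; apply: Wm; exact: (scaleM sW).
Qed.

Lemma sball_scale n x y : sball n x y -> W n (x^-1 * y)%g.
Proof. by move=> [m /(_ _ (scale1 m sW))]; rewrite mulg1. Qed.

Lemma sball_center n x : sball n x x.
Proof. by exists n => w; rewrite mulVg mul1g. Qed.

Lemma sball_diff n x y z : sball n.+1 x y -> sball n.+1 x z -> W n (y^-1 * z)%g.
Proof.
move=> /sball_scale xy /sball_scale xz; have := scaleVM xy xz.
by rewrite invgM invgK !mulgA mulgK.
Qed.

(** The balls around these centers, for all [n], form a countable base of the topology of the
    scale. *)
Lemma finite_sball_cover n : exists s : seq G, forall y, exists2 x, x \in s & sball n x y.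
Proof.
have := Gcompact; rewrite compact_cover => /(_ _ [set: G] (sball n)) [].
- by move=> x _; exact/scale_open_open/scale_open_sball.
- by move=> x _; exists x => //; exact: sball_center.
move=> D _ HD; exists (finmap.enum_fset D) => y.
by have [//|x xD xy] := HD y; exists x.
Qed.

(** The rectangles of base balls with product inside [O] are kept. There are countably many, which
    makes multiplication jointly measurable for the scale. *)
Lemma scale_openM_cover O : scale_open W O -> exists A B : nat -> nat -> nat -> set G,
  [/\ forall n i j, scale_open W (A n i j), forall n i j, scale_open W (B n i j) &
   forall x y, O (x * y)%g <-> exists n i j, A n i j x /\ B n i j y].
Proof.
move=> WO; have /choice[s sP] := finite_sball_cover.
pose c n i := nth 1%g (s n) i.
pose ok n i j := forall x y, sball n (c n i) x -> sball n (c n j) y -> O (x * y)%g.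
exists (fun n i j => [set x | ok n i j /\ sball n (c n i) x]).
exists (fun n i j => [set x | ok n i j /\ sball n (c n j) x]).
split=> [n i j x [h]|n i j x [h]|x y].
- by move=> /scale_open_sball[m Wm]; exists m => w /Wm.
- by move=> /scale_open_sball[m Wm]; exists m => w /Wm.
split=> [/WO[m Wm]|[n [i [j [[h xi] [_ yj]]]]]]; last exact: h.
have [p ps px] := sP m.+2 x; have [q qs qy] := sP m.+2 y.
(* Two levels are spent: points of a common ball of level [m + 2] differ by an element of level
   [m + 1], and the two differences, one conjugated by [y], multiply into level [m]. *)
exists m.+2, (index p (s m.+2)), (index q (s m.+2)).
rewrite /= /c !nth_index//.
suff h : ok m.+2 (index p (s m.+2)) (index q (s m.+2)) by [].
move=> x' y'; rewrite /c !nth_index// => px' qy'.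
have Wx := sball_diff px px'; have Wy := sball_diff qy qy'.
have := Wm _ (scaleM sW (scaleJ sW (y^-1)%g Wx) Wy).
by rewrite invgK !mulgA !mulgK mulgV mul1g.
Qed.

End scale_topology.

(** * Approximation of Borel sets up to Haar-null sets *)

Section haar_sandwich.
Context {R : realType}.
Variable mu : probability (g_sigma_algebraType (@open G)) R.
Hypothesis mu_mulr : forall (x : G) (E : set G), borel_sets E ->
  mu ((fun y => y * x)%g @^-1` E) = mu E.

Let borel := g_sigma_algebraType (@open G).
Let open_meas (U : set G) : open U -> measurable (U : set borel).
Proof. exact: sub_sigma_algebra. Qed.

(** Exhaustion: the supremum of the measures of scale-open subsets of [U], over all scales, is
    attained by a countable union after merging scales. Adjoining [V'] to [V] then cannot increase
    the measure. *)
Lemma max_scale_open_sub (U : set G) : exists W V, [/\ scale W, scale_open W V,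
  V `<=` U & forall W' V', scale W' -> scale_open W' V' -> V' `<=` U ->
    mu (V' `\` V) = 0%E].
Proof.
pose S := [set mu V | V in
  [set V : set G | (exists2 W, scale W & scale_open W V) /\ V `<=` U]].
have [W0 sW0 _] := exists_scale (filterT : nbhs (1%g : G) setT).
have S1 : (ereal_sup S <= 1)%E.
  apply: ge_ereal_sup => _ [V [[W sW WV] _] <-].
  by apply: probability_le1; exact: (open_meas (scale_open_open sW WV)).
have S0 : (0 <= ereal_sup S)%E.
  by apply: ereal_sup_ubound; exists set0; [split => //; exists W0|rewrite measure0].
have Sfin : ereal_sup S \is a fin_num.
  by rewrite ge0_fin_numE// (le_lt_trans S1)// ltry.
have /choice[F FP] (k : nat) : exists p : (nat -> set G) * set G,
    [/\ scale p.1, scale_open p.1 p.2, p.2 `<=` U &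
      (ereal_sup S - (k.+1%:R^-1)%:E < mu p.2)%E].
  have e0 : (0 < (k.+1%:R^-1 : R)) by rewrite invr_gt0.
  have [_ [V [[W sW WV] VU] <-] h] := ub_ereal_sup_adherent e0 Sfin.
  by exists (W, V).
have [W sW WF] : exists2 W, scale W & forall i, scale_open (F i).1 `<=` scale_open W.
  by apply: scale_merge => i; have [] := FP i.
pose V := \bigcup_i (F i).2.
have WV : scale_open W V.
  by apply: scale_open_bigcup => i; apply: (WF i); have [] := FP i.
have VU : V `<=` U by apply: bigcup_sub => i _; have [] := FP i.
have mV : measurable (V : set borel) by exact: (open_meas (scale_open_open sW WV)).
have SV : (ereal_sup S <= mu V)%E.
  apply/lee_addgt0Pr => e e0.
  pose k := Num.bound e^-1.
  have ke : k.+1%:R^-1 <= e.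
    rewrite -[leRHS]invrK lef_pV2 ?posrE ?invr_gt0//.
    apply: ltW; apply: lt_trans (archi_boundP _) _; first by rewrite invr_ge0 ltW.
    by rewrite ltr_nat.
  have [sk Wk _ h] := FP k.
  rewrite -leeBlDr//; apply: (@le_trans _ _ (ereal_sup S - (k.+1%:R^-1)%:E)%E).
    by rewrite leeB// lee_fin.
  apply: le_trans (ltW h) _; apply: le_measure; rewrite ?inE//.
    exact: (open_meas (scale_open_open sk Wk)).
  by move=> x Fx; exists k.
exists W, V; split => // W' V' sW' WV' VU'.
have mV' : measurable (V' : set borel) by exact: (open_meas (scale_open_open sW' WV')).
have [W2 sW2 H2] := @scale_merge
  (fun i => if i is 0%N then W else W') (fun i => match i with 0%N => sW | _ => sW' end).
have WVV : scale_open W2 (V `|` V').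
  by apply: scale_openU; [apply: (H2 0%N)|apply: (H2 1%N)].
have : (mu (V `|` V') <= mu V)%E.
  apply: le_trans SV; apply: ereal_sup_ubound; exists (V `|` V') => //; split.
    by exists W2.
  by rewrite subUset.
have -> : V `|` V' = V `|` (V' `\` V) 
  by apply/seteqP; split=> x /=; case: (pselect (V x)); tauto.
have mD : measurable (V' `\` V : set borel) by exact: measurableD.
rewrite measureU//; last by rewrite setDE setICA setICr setI0.
rewrite -[leRHS]adde0 leeD2lE ?fin_num_measure// => h.
by apply/eqP; rewrite eq_le h measure_ge0.
Qed.

(** Finitely many of the sets [O] cover [G], and the largest of their levels [n] works because [W]
    is decreasing. *)
Let locally_null (W : nat -> set G) (V : set G) (u : G) : scale W ->
  (forall p, exists O, [/\ open O, O p & exists n,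
    mu.-negligible ((O `&` [set y | W n (u^-1 * y)%g]) `\` V)]) ->
  exists n, mu.-negligible ([set y | W n (u^-1 * y)%g] `\` V).
Proof.
move=> sW /choice [nb nbP].
have := Gcompact; rewrite compact_cover => /(_ _ [set: G] nb) [].
- by move=> p _; have [] := nbP p.
- by move=> p _; exists p => //; have [] := nbP p.
move=> D _ HD.
have [n Hn] : exists n, mu.-negligible
    (([set x | exists2 p, p \in finmap.enum_fset D & nb p x] `&`
      [set y | W n (u^-1 * y)%g]) `\` V).
  elim: (finmap.enum_fset D) => [|p s [n IH]].
    by exists 0%N; apply: negligibleS (negligible_set0 _) => x [[[]]].
  have [_ _ [m Hm]] := nbP p.
  exists (maxn m n); apply: negligibleS (negligibleU Hm IH) => x [[[q + Oq] Wx] nV].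
  rewrite inE => /predU1P[qp|qs]; [left|right]; split => //; split.
  - by rewrite -qp.
  - by apply: (scale_le sW _ Wx); exact: leq_maxl.
  - by exists q.
  - by apply: (scale_le sW _ Wx); exact: leq_maxr.
exists n; apply: negligibleS Hn => x [Wx nV]; split => //; split => //.
by have [//|p pD Opx] := HD x; exists p.
Qed.

(* Take [V] as in [max_scale_open_sub]. Every scale-open subset of a translate
   [U n] of [U] by a point [n] of the intersection of the [W n] is contained in [V]
   up to a null set, since [V n = V]. By compactness, every point of [U] then has a
   neighborhood [u W_n] contained in [V] up to a null set. *)
Lemma sandwich_open (U : set G) : open U -> exists W V O,
  [/\ scale W, scale_open W V, scale_open W O, V `<=` U /\ U `<=` O & mu (O `\` V) = 0%E].
Proof.
move=> oU; have [W [V [sW WV VU Vmax]]] := max_scale_open_sub U.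
have mV : measurable (V : set borel) by exact: (open_meas (scale_open_open sW WV)).
exists W, V.
have null_nbhs u : U u -> exists n, mu.-negligible ([set y | W n (u^-1 * y)%g] `\` V).
  move=> Uu; apply: locally_null => // p.
  (* If [p] is outside the coset of [u] modulo the intersection of the [W n], a ball about [p]
     misses [u W_n] for some [n]. *)
  have [Np|] := pselect (forall n, W n (u^-1 * p)%g); last first.
    move=> /existsNP[n Wnp]; exists (sball W n.+1 p); split.
    - by apply: (scale_open_open sW); exact: scale_open_sball.
    - exact: sball_center.
    - exists n.+1; apply: negligibleS (negligible_set0 _) => y [[/(sball_scale sW) Wpy Wuy] _].
      apply: Wnp; have := scaleM sW Wuy (scaleV sW Wpy).
      by rewrite invgM invgK !mulgA mulgK.
  have : nbhs (1%g : G) ((fun y => u * y)%g @^-1` U).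
    by apply: (@continuous_mulgl u 1%g); rewrite mulg1; exact: open_nbhs_nbhs.
  move=> /exists_scale[W' sW' W'U].
  pose V' := [set y | exists m, forall w, W' m w -> U (y * w)%g].
  have WV' : scale_open W' V'.
    move=> y [m Hm]; exists m.+1 => w Ww; exists m.+1 => v Wv.
    by rewrite -mulgA; apply: Hm; exact: (scaleM sW').
  have VU' : V' `<=` U by move=> y [m /(_ _ (scale1 m sW'))]; rewrite mulg1.
  have V'u : V' u by exists 0%N => w /W'U.
  have mV' : measurable (V' : set borel) by exact: (open_meas (scale_open_open sW' WV')).
  have V'V := Vmax _ _ sW' WV' VU'.
  (* [c] lies in every [W n]. Pulling back along right translation by [c] turns the neighborhood
     [V'] of [u] into one of [p], preserves null sets and leaves [V] fixed. *)
  pose c := (p^-1 * u)%g.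
  have oV' := scale_open_open sW' (@scale_open_mulr W' sW' c V' WV').
  exists ((fun y => y * c)%g @^-1` V'); split => //.
    by rewrite /preimage/= /c mulgA mulgV mul1g.
  exists 0%N; exists ((fun y => y * c)%g @^-1` (V' `\` V)); split.
  - apply: (measurableD (open_meas oV')).
    exact: (open_meas (scale_open_open sW (@scale_open_mulr W sW c V WV))).
  - by rewrite mu_mulr//; exact: (measurableD mV' mV).
  - move=> y [[V'y _] nVy]; split => // /WV[m Wm]; apply: nVy.
    have := Wm _ (Np m); rewrite /c !mulgA.
    by rewrite mulgK mulgVK.
have /choice[s sP] := finite_sball_cover sW.
(* Only base balls that are null outside [V] are kept; being countably many, together they exceed
   [V] by a null set. *)
pose A n i := if pselect (mu.-negligible (sball W n (nth 1%g (s n) i) `\` V))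
  is left _ then sball W n (nth 1%g (s n) i) else set0.
have WA n i : scale_open W (A n i).
  by rewrite /A; case: pselect => _ x; [exact: (scale_open_sball sW)|case].
have WO : scale_open W (\bigcup_n \bigcup_i A n i).
  by apply: scale_open_bigcup => n; exact: scale_open_bigcup.
exists (\bigcup_n \bigcup_i A n i); split => //.
- split=> // u Uu; have [n Hn] := null_nbhs u Uu.
  (* A ball of level [n + 1] containing [u] lies inside [u W_n]. *)
  have [x xs ux] := sP n.+1 u.
  exists n.+1 => //; exists (index x (s n.+1)) => //.
  rewrite /A nth_index//; case: pselect => // -[].
  apply: negligibleS Hn => y [xy nVy]; split => //.
  exact: (sball_diff sW ux xy).
- apply: measure_negligible.
    by apply: measurableD => //; exact: (open_meas (scale_open_open sW WO)).
  rewrite setD_bigcupl; apply: negligible_bigcup => n.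
  rewrite setD_bigcupl; apply: negligible_bigcup => i.
  rewrite /A; case: pselect => // _.
  by rewrite set0D; exact: negligible_set0.
Qed.

(** The sets with such a sandwich form a sigma-algebra containing the open sets; for countable
    unions the scales are merged. *)
Lemma sandwich_borel (E : set G) : borel_sets E -> exists W B1 B2,
  [/\ scale W, <<s scale_open W >> B1, <<s scale_open W >> B2,
      B1 `<=` E /\ E `<=` B2 & mu (B2 `\` B1) = 0%E].
Proof.
pose Q (E : set G) := exists W B1 B2,
  [/\ scale W, <<s scale_open W >> B1, <<s scale_open W >> B2,
      B1 `<=` E /\ E `<=` B2 & mu (B2 `\` B1) = 0%E].
suff : borel_sets (G := G) `<=` Q by exact.
apply: smallest_sub => [|U /sandwich_open[W [V [D [sW WV WD VUD mu0]]]]]; last first.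
  by exists W, V, D; split => //; exact: sub_sigma_algebra.
split.
- have [W sW _] := exists_scale (filterT : nbhs (1%g : G) setT).
  exists W, set0, set0; split => //.
  + exact: sigma_algebra0.
  + exact: sigma_algebra0.
  + by split.
  + by rewrite setDv measure0.
- move=> C [W [B1 [B2 [sW s1 s2 [C1 C2] m0]]]].
  exists W, (setT `\` B2), (setT `\` B1); split => //.
  + exact: sigma_algebraCD.
  + exact: sigma_algebraCD.
  + by split; exact: setDS.
  + rewrite -m0; congr (mu _); apply/seteqP; split => x /=; case: (pselect (B2 x)); tauto.
- move=> F FQ.
  have /choice[W /choice[B1 /choice[B2 H]]] := FQ.
  have [W' sW' WW'] : exists2 W', scale W' & forall i, scale_open (W i) `<=` scale_open W'.
    by apply: scale_merge => i; have [] := H i.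
  have s1 i : <<s scale_open W' >> (B1 i).
    by have [_ h _ _ _] := H i; apply: sub_sigma_algebra2 h; exact: WW'.
  have s2 i : <<s scale_open W' >> (B2 i).
    by have [_ _ h _ _] := H i; apply: sub_sigma_algebra2 h; exact: WW'.
  have sb (C : set G) : <<s scale_open W' >> C -> measurable (C : set borel).
    by apply: sub_sigma_algebra2; exact: scale_open_open.
  exists W', (\bigcup_i B1 i), (\bigcup_i B2 i); split => //.
  + exact: sigma_algebra_bigcup.
  + exact: sigma_algebra_bigcup.
  + by split; apply: subset_bigcup => i _; have [_ _ _ []] := H i.
  + apply: measure_negligible.
      by apply: measurableD; apply: bigcupT_measurable => i; exact: sb.
    have : mu.-negligible (\bigcup_i (B2 i `\` B1 i)).
      apply: negligible_bigcup => i; apply/negligibleP.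
        by apply: measurableD; exact: sb.
      by have [] := H i.
    apply: negligibleS => x [[i _ b2] nb1]; exists i => //; split => // b1.
    by apply: nb1; exists i.
Qed.

End haar_sandwich.

Lemma scale_measurable_borel (W : nat -> set G) : scale W ->
  <<s scale_open W >> `<=` borel_sets (G := G).
Proof. by move=> sW; apply: sub_sigma_algebra2; exact: scale_open_open. Qed.

(** The sets [{f > q}], [q] rational, are sandwiched in one scale and [N] collects the gaps. The
    value 0 on [N] keeps any bound on [|f|] valid for [g] everywhere. *)
Lemma borel_eq_off_null {R : realType}
  (mu : probability (g_sigma_algebraType (@open G)) R)
  (mu_mulr : forall (x : G) (E : set G), borel_sets E ->
    mu ((fun y => y * x)%g @^-1` E) = mu E) (f : G -> R) :
  borel_measurable_fun f -> exists W (N : set G) (g : G -> R),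
  [/\ scale W, <<s scale_open W >> N, mu N = 0%E,
      @measurable_fun _ _ (g_sigma_algebraType (scale_open W)) R setT g &
      forall x, g x = f x \/ N x /\ g x = 0].
Proof.
move=> mf.
(* Enumerates the rationals; numbers coding no rational default to 0. *)
pose q (n : nat) : R := ratr (odflt 0%Q (unpickle n)).
have bE n : borel_sets [set x | q n < f x].
  have := mf measurableT _ (measurable_itv `]q n, +oo[).
  rewrite setTI (_ : _ @^-1` _ = [set x | q n < f x])//.
  by apply/seteqP; split=> x; rewrite /= in_itv/= andbT.
have /choice[W' /choice[B1 /choice[B2 H]]] n := sandwich_borel mu_mulr (bE n).
have [W sW WW'] : exists2 W, scale W & forall i, scale_open (W' i) `<=` scale_open W.
  by apply: scale_merge => i; have [] := H i.
have s1 i : <<s scale_open W >> (B1 i).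
  by have [_ h _ _ _] := H i; apply: sub_sigma_algebra2 h; exact: WW'.
have s2 i : <<s scale_open W >> (B2 i).
  by have [_ _ h _ _] := H i; apply: sub_sigma_algebra2 h; exact: WW'.
pose T := g_sigma_algebraType (scale_open W).
pose N := \bigcup_i (B2 i `\` B1 i).
have mN : measurable (N : set T).
  by apply: bigcupT_measurable => i; apply: measurableD; [exact: s2|exact: s1].
pose g x := if pselect (N x) is left _ then 0 else f x.
have gN x : N x -> g x = 0 by rewrite /g; case: pselect.
have gf x : ~ N x -> g x = f x by rewrite /g; case: pselect.
exists W, N, g; split => //.
- apply: measure_negligible; first exact: scale_measurable_borel sW _ mN.
  apply: negligible_bigcup => i; apply/negligibleP.
    by apply: measurableD; [exact: scale_measurable_borel sW _ (s2 i)|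
      exact: scale_measurable_borel sW _ (s1 i)].
  by have [] := H i.
- apply: (measurability _ (RGenOInfty.measurableE R)) => _ [_ [c ->] <-].
  (* Off [N], [B1 n] agrees with [{f > q n}]; on [N], where [g = 0], the condition [g > c] means
     [c < q n < 0] for some [n]. *)
  pose F n : set T := if c < q n then (B1 n `\` N) `|` (if q n < 0 then N else set0) else set0.
  have mF n : measurable (F n).
    rewrite /F; case: ifP => // _; apply: measurableU.
      by apply: measurableD => //; exact: s1.
    by case: ifP.
  rewrite (_ : _ `&` _ = \bigcup_n F n); first exact: bigcupT_measurable.
  rewrite setTI; apply/seteqP; split=> x; rewrite /= in_itv/= andbT.
    move=> cg; have [r rcg] := rat_in_itvoo cg.
    move: rcg; rewrite in_itv/= => /andP[cr rg].
    have qr : q (pickle r) = ratr r by rewrite /q pickleK.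
    exists (pickle r) => //; rewrite /F qr cr.
    have [Nx|nNx] := pselect (N x).
      by right; rewrite gN// in rg; rewrite rg.
    left; split => //; rewrite gf// in rg.
    have [_ _ _ [_ EB2] _] := H (pickle r).
    apply: contrapT => nB1; apply: nNx; exists (pickle r) => //; split => //.
    by apply: EB2; rewrite /= qr.
  move=> [n _]; rewrite /F; case: ifPn => // cq [[B1x nNx]|].
    rewrite gf//; apply: (lt_trans cq).
    by have [_ _ _ [+ _] _] := H n => /(_ _ B1x).
  case: ifPn => // q0 Nx; rewrite gN//; exact: lt_trans q0.
- move=> x; have [Nx|nNx] := pselect (N x); first by right; split => //; exact: gN.
  by left; exact: gf.
Qed.

(** * Measurability of the group operations for one scale *)

Section scale_measurability.
Context (W : nat -> set G).
Hypothesis sW : scale W.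
Let T := g_sigma_algebraType (scale_open W).

Lemma measurable_scale_mul :
  measurable_fun [set: T * T] (fun p : T * T => ((p.1 : G) * (p.2 : G))%g : T).
Proof.
apply: (@measurability _ _ _ T setT _ (scale_open W) erefl) => _ [D WD <-].
have [A [B [WA WB AB]]] := scale_openM_cover sW WD.
rewrite setTI (_ : _ @^-1` _ = \bigcup_n \bigcup_i \bigcup_j (A n i j `*` B n i j)).
  do 3!apply: bigcupT_measurable => ?.
  by apply: measurableX; exact: sub_sigma_algebra.
apply/seteqP; split => [[x y] /= /AB[n [i [j [Ax By]]]]|[x y] [n _ [i _ [j _ [Ax By]]]]].
  by exists n => //; exists i => //; exists j.
by apply/AB; exists n, i, j.
Qed.

Lemma measurable_scale_inv :
  measurable_fun [set: T] (fun x : T => ((x : G)^-1)%g : T).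
Proof.
apply: (@measurability _ _ _ T setT _ (scale_open W) erefl) => _ [D WD <-]; rewrite setTI.
by apply: sub_sigma_algebra; exact: scale_open_inv.
Qed.

Lemma grv_scale_measurable d (Omega : measurableType d) (X : Omega -> G) :
  is_grv X -> measurable_fun [set: Omega] (X : Omega -> T).
Proof. by move=> mX _ E sE; apply: mX => //; exact: scale_measurable_borel sW _ sE. Qed.

Lemma same_law_Rintegral (R : realType) d (Omega : measurableType d)
    (P : probability Omega R) (X X' : Omega -> G) (h : T -> R) :
  is_grv X -> is_grv X' -> same_law P P X X' -> bmf h ->
  \int[P]_w h (X w) = \int[P]_w h (X' w).
Proof.
move=> gX gX' XX' bh.
rewrite -(Rintegral_law P (grv_scale_measurable gX) bh).
rewrite -(Rintegral_law P (grv_scale_measurable gX') bh).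
by apply: eq_law_Rintegral => E /(scale_measurable_borel sW); exact: XX'.
Qed.

End scale_measurability.

Lemma continuous_grv d (Omega : measurableType d) (k : G -> G) (X : Omega -> G) :
  continuous k -> is_grv X -> is_grv (k \o X).
Proof.
move=> /continuousP ck mX; apply: measurableT_comp mX.
apply: (@measurability _ _ _ (g_sigma_algebraType (@open G)) setT _ open erefl).
move=> _ [D oD <-]; rewrite setTI.
by apply: sub_sigma_algebra; exact: ck.
Qed.

End compact_group.

(** * Transfer of the bounds from the quotient to [f] *)

Theorem theorem1p2
  (R : realType)
  (* the compact topological group G *)
  (G : TopGroup.type)
  (Gmul_cont : continuous (fun p : G * G => (p.1 * p.2)%g))
  (Ginv_cont : continuous (fun x : G => (x^-1)%g))
  (Gcompact : compact [set: G])
  (* the probability space carrying X and Y *)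
  (d : measure_display) (Omega : measurableType d) (P : probability Omega R)
  (X Y : Omega -> G)
  (X_rv : is_grv X) (Y_rv : is_grv Y)
  (X_haar : haar_distributed P X)
  (XY_indep : indep2 P X Y)
  (Y_sym : same_law P P Y (fun w => ((Y w)^-1)%g))
  (Y_conj : forall x : G, same_law P P Y (fun w => (x * Y w * x^-1)%g))
  (* the function f *)
  (f : G -> R) (f_meas : borel_measurable_fun f)
  (f_mean0 : ('E_P[f \o X] = 0)%E)
  (* i.i.d. copies Y_1, Y_2, ... of Y (indexed from 0), on some probability space *)
  (d' : measure_display) (Omega' : measurableType d') (P' : probability Omega' R)
  (Ys : nat -> Omega' -> G)
  (Ys_rv : forall i, is_grv (Ys i))
  (Ys_law : forall i, same_law P' P (Ys i) Y)
  (Ys_indep : mutually_indep P' Ys)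
  (Ys_prod_rv : forall k : nat, is_grv (fun w => (\prod_(i < k) Ys i w)%g))
  (* mixing constants *)
  (a b : R) (a_gt0 : 0 < a) (b_gt0 : 0 < b)
  (mixing : forall k : nat, (1 <= k)%N ->
     (dTV P' P (fun w => (\prod_(i < k) Ys i w)%g) X
        <= (a * expR (- (b * k%:R)))%:E)%E)
  (* norm bounds *)
  (A B : R) (A_gt0 : 0 < A) (B_gt0 : 0 < B)
  (fA : (sup_norm f <= A%:E)%E) (fB : (Y_norm P Y f <= B%:E)%E)
  (C : R)
  (C_def : C = B ^+ 2 / b *
              (Num.max (ln (4 * a * A / B)) 0 + b / (1 - expR (- b)))) :
  ('V_P[f \o X] <= (C / 2)%:E)%E /\
  (forall t : R, 0 <= t ->
     (P [set w | (t <= `| f (X w) |)%R] <= (2 * expR (- (t ^+ 2) / C))%:E)%E).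
Proof.
have fbd x : `|f x| <= A.
  by rewrite -lee_fin (le_trans _ fA)//; apply: ereal_sup_ubound; exists x.
have grvL x (V : Omega -> G) : is_grv V -> is_grv (fun w => (x * V w)%g).
  exact: (@continuous_grv G _ _ _ V (@continuous_mulgl G Gmul_cont x)).
have grvR x (V : Omega -> G) : is_grv V -> is_grv (fun w => (V w * x)%g).
  exact: (@continuous_grv G _ _ _ V (@continuous_mulgr G Gmul_cont x)).
have grvV (V : Omega -> G) : is_grv V -> is_grv (fun w => ((V w)^-1)%g).
  exact: (@continuous_grv G _ _ _ V Ginv_cont).
have bfX (V : Omega -> G) : is_grv V -> bmf (fun w => f (V w)).
  move=> gV; split; first exact: (measurableT_comp f_meas gV).
  by exists A.
have fvar x : \int[P]_w ((f x - f (Y w * x)%g) ^+ 2) <= B ^+ 2.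
  have : Num.sqrt (\int[P]_w ((f x - f (Y w * x)%g) ^+ 2)) <= B.
    rewrite -lee_fin (le_trans _ fB)//; apply: ereal_sup_ubound; exists x => //.
    by rewrite unlock.
  set v := \int[P]_w _ => sB.
  have v0 : 0 <= v by apply: Rintegral_ge0 => w _; exact: sqr_ge0.
  by rewrite -(sqr_sqrtr v0) ler_sqr// nnegrE// ltW.
pose muG : probability (g_sigma_algebraType (@open G)) R :=
  @law _ _ _ _ (g_sigma_algebraType (@open G)) P X X_rv.
have mu_mulr (x : G) (E : set G) : borel_sets E ->
    muG ((fun y => y * x)%g @^-1` E) = muG E.
  by move=> bE; have [_ /(_ _ bE) XE _] := X_haar x; exact: esym XE.
have [W [N [g [sW mN N0 mg gE]]]] :=
  borel_eq_off_null Gmul_cont Ginv_cont Gcompact mu_mulr f_meas.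
pose T := g_sigma_algebraType (scale_open W).
have gbd x : `|g x| <= A.
  by have [->//|[_ ->]] := gE x; rewrite normr0 ltW.
have bg : bmf (g : T -> R) by split; [|exists A].
have gf x : ~ N x -> g x = f x by have [->//|[]] := gE x.
pose mul (x y : T) : T := ((x : G) * (y : G))%g.
pose inv (x : T) : T := ((x : G)^-1)%g.
have mmul : measurable_fun [set: T * T] (fun p => mul p.1 p.2).
  exact: (@measurable_scale_mul G Gmul_cont Gcompact W sW).
have mulA : associative mul by move=> x y z; exact: mulgA.
have mulKV x y : mul y (mul (inv y) x) = x by exact: mulVKg.
have mX : measurable_fun setT (X : Omega -> T).
  exact: (@grv_scale_measurable G Gmul_cont W sW).
have mY : measurable_fun setT (Y : Omega -> T).
  exact: (@grv_scale_measurable G Gmul_cont W sW).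
have mYs i : measurable_fun setT (Ys i : Omega' -> T).
  exact: (@grv_scale_measurable G Gmul_cont W sW).
have bor E : measurable (E : set T) -> borel_sets E.
  exact: (scale_measurable_borel Gmul_cont sW).
have mNX : measurable (X @^-1` N).
  by rewrite -[_ @^-1` _]setTI; exact: (mX measurableT _ mN).
pose mu : probability T R := law P mX.
pose nu : probability T R := law P mY.
have bmul1 x (h : T -> R) : bmf h -> bmf (fun y => h (mul x y)) by exact: bmf_mull.
have bmul2 x (h : T -> R) : bmf h -> bmf (fun y => h (mul y x)) by exact: bmf_mulr.
have mu_invl x (h : T -> R) : bmf h -> \int[mu]_y h (mul x y) = \int[mu]_y h y.
  move=> bh; rewrite !Rintegral_law//; last exact: bmul1.
  have [XX' _ _] := X_haar x.
  by apply/esym; exact: (same_law_Rintegral Gmul_cont sW X_rv (grvL x X X_rv) XX' bh).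
have mu_invr x (h : T -> R) : bmf h -> \int[mu]_y h (mul y x) = \int[mu]_y h y.
  move=> bh; rewrite !Rintegral_law//; last exact: bmul2.
  have [_ XX' _] := X_haar x.
  by apply/esym; exact: (same_law_Rintegral Gmul_cont sW X_rv (grvR x X X_rv) XX' bh).
have nu_sym (h : T -> R) : bmf h -> \int[nu]_y h (inv y) = \int[nu]_y h y.
  move=> bh; rewrite !Rintegral_law//.
    by apply/esym; exact: (same_law_Rintegral Gmul_cont sW Y_rv (grvV Y Y_rv) Y_sym bh).
  by apply: bmf_comp bh; exact: (@measurable_scale_inv G W sW).
have nu_conj y (h : T -> R) : bmf h ->
    \int[nu]_z h (mul z y) = \int[nu]_z h (mul y z).
  move=> bh; rewrite !Rintegral_law//; [|exact: bmul1|exact: bmul2].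
  have Yc := grvR (y^-1)%g _ (grvL y _ Y_rv).
  rewrite [LHS](same_law_Rintegral Gmul_cont sW Y_rv Yc (Y_conj y) (bmul2 y h bh)).
  by apply: eq_Rintegral => w _; rewrite /mul mulgVK.
have g0 : \int[mu]_x g x = 0.
  rewrite Rintegral_law//.
  have -> : \int[P]_w g (X w) = \int[P]_w f (X w).
    apply: (@Rintegral_eq_off_null _ _ _ P (X @^-1` N)) => //.
    - exact: bmf_comp bg.
    - exact: bfX.
    - by move=> w; exact: gf.
  by move: f_mean0; rewrite unlock /Rintegral /comp => ->.
(* Changes on [N] are charged to [N]: [step_var g <= B^2 + K (1_N + P 1_N)], where [K] is the square
   of the bound [2 A] for [|g x - g z|]. The last term has integral 0, since [mu] is stationary and
   [N] is null. *)
have gvar : ess_le mu (step_var mul nu g) (B ^+ 2).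
  have bN : bmf (\1_N : T -> R) by exact: bmf_indic.
  have sN : \int[mu]_x (\1_N x + step mul nu \1_N x) = 0.
    rewrite bmf_RintegralD//; last exact: (bmf_step mu nu mmul bN).
    rewrite Rintegral_mu_step// Rintegral_indic//.
    by rewrite (_ : mu N = 0%E)// addr0.
  pose K := 4 * A ^+ 2.
  have K0 : 0 <= K by rewrite mulr_ge0// sqr_ge0.
  have bstep : bmf (step mul nu \1_N) by exact: (bmf_step mu nu mmul bN).
  have bvar : bmf (step_var mul nu g) by exact: (bmf_step_var mu nu mmul bg).
  have le_pt (x z : G) : (g x - g z) ^+ 2 <= (f x - f z) ^+ 2 + K * (\1_N x + \1_N z).
    have big : (g x - g z) ^+ 2 <= K.
      have := gbd x; have := gbd z; rewrite !ler_norml => /andP[z1 z2] /andP[x1 x2].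
      rewrite -subr_ge0 (_ : K - _ = (2 * A - (g x - g z)) * (2 * A + (g x - g z))).
        by apply: mulr_ge0; lra.
      by rewrite /K; ring.
    rewrite !indicE; have [xN|xN] := boolP (x \in N).
      by rewrite (le_trans big)// -[leLHS]add0r lerD ?sqr_ge0// ler_peMr// lerDl.
    have [zN|zN] := boolP (z \in N).
      by rewrite (le_trans big)// add0r mulr1 lerDr sqr_ge0.
    rewrite addr0 mulr0 addr0 !gf//; first by move: zN; rewrite notin_setE.
    by move: xN; rewrite notin_setE.
  have le_var x : step_var mul nu g x <= B ^+ 2 + K * (\1_N x + step mul nu \1_N x).
    have b1 : bmf (fun w => (f x - f (Y w * x)%g) ^+ 2).
      by apply/bmfX/bmfB; [exact: bmf_cst|exact: (bfX _ (grvR x Y Y_rv))].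
    have b2 : bmf (fun w => \1_N (Y w * x)%g : R) by exact: bmf_comp (bmul2 x _ bN).
    rewrite /step_var /step !Rintegral_law//; last 2 first.
    - exact: bmul2.
    - by apply/bmfX/bmfB; [exact: bmf_cst|exact: bmul2].
    have b3 : bmf (fun w => \1_N x + \1_N (Y w * x)%g : R).
      by apply: bmfD => //; exact: bmf_cst.
    have b4 : bmf (fun w => K * (\1_N x + \1_N (Y w * x)%g) : R).
      by apply: bmfM => //; exact: bmf_cst.
    apply: (@le_trans _ _ (\int[P]_w ((f x - f (Y w * x)%g) ^+ 2 +
        K * (\1_N x + \1_N (Y w * x)%g)))); last first.
      rewrite bmf_RintegralD// bmf_RintegralZ// bmf_RintegralD//; last exact: bmf_cst.
      by rewrite probability_Rintegral_cst lerD2r.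
    apply: bmf_le_Rintegral => [| |w].
    - by apply/bmfX/bmfB; [exact: bmf_cst|exact: (bmf_comp mY (bmul2 x _ bg))].
    - exact: (bmfD b1 b4).
    - exact: le_pt.
  apply/eqP; rewrite eq_le Rintegral_ge0 ?andbT; last first.
    by move=> x _; rewrite le_max lexx orbT.
  rewrite -[leRHS](mulr0 K) -[X in K * X]sN -bmf_RintegralZ//; last exact: bmfD.
  apply: bmf_le_Rintegral => [| |x].
  - exact: (bmf_excess (B ^+ 2) bvar).
  - by apply: bmfM; [exact: bmf_cst|exact: bmfD].
  - have ind0 y : 0 <= \1_N y :> R by rewrite indicE; case: (_ \in _).
    rewrite ge_max lerBlDl le_var mulr_ge0// addr_ge0//.
    by apply: Rintegral_ge0 => y _; exact: ind0.
pose Z k w : T := (\prod_(i < k) Ys i w)%g.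
have Z0 : Z 0%N = fun=> (1%g : G) by apply/funext => w; rewrite /Z big_ord0.
have ZS k : Z k.+1 = fun w => mul (Z k w) (Ys k w).
  by apply/funext => w; rewrite /Z big_ord_recr.
have mZ k : measurable_fun setT (Z k).
  exact: (@grv_scale_measurable G Gmul_cont W sW _ _ _ (Ys_prod_rv k)).
have Yindep n (E : nat -> set T) : (forall i, measurable (E i)) ->
    fine (P' (\bigcap_(i in `I_n) (Ys i @^-1` E i))) =
    \prod_(i < n) fine (P' (Ys i @^-1` E i)).
  by move=> mE; apply: Ys_indep => i; exact: bor.
(* A step inserts its factor next to the starting point, so on the right of the earlier product, in
   the order of [Z]. *)
have walkE k x : iter k (step mul nu) g x = \int[P']_w g (mul (Z k w) x).
  elim: k x => [|k IH] x.
    by rewrite Z0 /mul; under eq_Rintegral do rewrite mul1g;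
      rewrite probability_Rintegral_cst.
  rewrite iterS {1}/step ZS.
  have bh : bmf (fun p : T * T => g (mul (mul p.1 p.2) x)).
    exact: (bmf_comp mmul (bmul2 x _ bg)).
  rewrite [RHS](Rintegral_walk_step mmul mYs Z0 ZS Yindep k bh).
  transitivity (\int[nu]_y \int[P']_w g (mul (mul (Z k w) y) x)); last first.
    by apply: eq_law_Rintegral => E /bor bE; exact: (esym (Ys_law k E bE)).
  by apply: eq_Rintegral => y _; rewrite IH; apply: eq_Rintegral => w _; rewrite mulA.
have decay k (x : T) : (1 <= k)%N ->
    `|iter k (step mul nu) g x| <= 2 * A * (a * expR (- (b * k%:R))).
  move=> k1; rewrite walkE -(Rintegral_law P' (mZ k) (bmul2 x _ bg)).
  (* By right invariance 0 is the expectation of [g(X x)], so the laws of [Z k] and [X] are compared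
     on the single function [y -> g(y x)]. *)
  rewrite -[X in `|X|]subr0 -[X in _ - X]g0 -(mu_invr x)//.
  apply: tv_Rintegral => //; [|exact: bmul2].
  move=> E /bor bE; rewrite -lee_fin (le_trans _ (mixing _ k1))//.
  by apply: ereal_sup_ubound; exists E.
split.
  rewrite /variance unlock f_mean0 unlock.
  have bfX2 : bmf (fun w => f (X w) ^+ 2) by apply: bmfX; exact: bfX.
  rewrite (_ : (\int[P]_w _ = \int[P]_w (f (X w) ^+ 2)%:E)%E); last first.
    apply: eq_integral => w _; congr EFin.
    by rewrite -[LHS]/((f (X w) - 0) * (f (X w) - 0)) subr0.
  rewrite EFin_bmf_Rintegral// lee_fin.
  have := walk_variance mulA mulKV mmul mu_invl nu_sym nu_conj bg a_gt0 b_gt0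
    A_gt0 B_gt0 gvar decay.
  rewrite -C_def; apply: le_trans.
  rewrite Rintegral_law//; last exact: bmfX.
  rewrite (@Rintegral_eq_off_null _ _ _ P (X @^-1` N) _ (fun w => g (X w) ^+ 2))//.
  - by apply: bmfX; exact: bmf_comp bg.
  - by move=> w Nw; rewrite gf.
move=> t t0.
have := walk_tail mulA mulKV mmul mu_invl nu_sym nu_conj bg a_gt0 b_gt0
  A_gt0 B_gt0 gvar decay t0.
rewrite -C_def; apply: le_trans.
have mt (V : Omega -> R) : measurable_fun setT V -> measurable [set w | t <= `|V w|].
  move=> mV; have mnV : measurable_fun setT (fun w => `|V w|) by exact: measurableT_comp.
  rewrite (_ : [set w | _] = [set: Omega] `&` (fun w => `|V w|) @^-1` `[t, +oo[).
    by apply: mnV => //; exact: measurable_itv.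
  by apply/seteqP; split=> w /=; rewrite in_itv/= andbT => // -[].
have mgX : measurable_fun setT (g \o X : Omega -> R) by exact: (measurableT_comp mg mX).
have -> : mu [set x | t <= `|g x|] = P [set w | t <= `|g (X w)|] by [].
apply: (@le_trans _ _ (P ([set w | t <= `|g (X w)|] `|` X @^-1` N))).
  apply: le_measure; rewrite ?inE.
  - by apply: mt; have [] := bfX X X_rv.
  - by apply: measurableU => //; exact: mt mgX.
  - move=> w /= tf; have [|nN] := pselect (N (X w)); first by right.
    by left; rewrite gf.
apply: le_trans (measureU2 _ (mt _ mgX) mNX) _.
by rewrite [X in (_ + X <= _)%E](_ : _ = 0%E) ?adde0.
Qed.
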